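(* For all $z\in\mathbb{C}\setminus\{0\}$ with $|\arg z|<\pi$, $$W(z)=\alpha_0+\frac{1}{\pi}\int_0^\pi K(z,v)\,t(v)\,dv ,$$ where $\alpha_0=\operatorname{Re}W(i)$ (numerically $0.3746990\ldots$), $$K(z,v)=\frac{\left(1+z\,t(v)\right)\left(v^2+(1-v\cot v)^2\right)}{\left(z-t(v)\right)\left(1+t^2(v)\right)},\qquad t(v)=-v\csc(v)\,e^{-v\cot v}.$$
   Context: $W$ denotes the principal branch of the Lambert $W$ function: the unique holomorphic function on $\mathbb{C}\setminus(-\infty,-1/e]$ with $W(z)e^{W(z)}=z$ and $W(0)=0$. $|\arg z|<\pi$ means $z\in\mathbb{C}\setminus(-\infty,0]$. $t^2(v)$ means $(t(v))^2$. *)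

(* Defs.v *)
From Stdlib Require Export Reals.
From Coquelicot Require Export Coquelicot.

Open Scope R_scope.

Definition Cexp (w : C) : C :=
  (exp (Re w) * cos (Im w), exp (Re w) * sin (Im w)).

(* The half-line (-oo, a] of the real axis, as a subset of the complex plane. *)
Definition on_cut (a : R) (z : C) : Prop := Im z = 0 /\ Re z <= a.

Definition holomorphic_at (f : C -> C) (z : C) : Prop :=
  @ex_derive C_AbsRing C_NormedModule f z.

(* Characterizes W only off the cut (-oo, -1/e]; its values on the cut are
   unconstrained. *)
Definition is_LambertW0 (W : C -> C) : Prop :=
  (forall z : C, ~ on_cut (- / exp 1) z -> holomorphic_at W z) /\
  (forall z : C, ~ on_cut (- / exp 1) z -> (W z * Cexp (W z))%C = z) /\
  W (RtoC 0) = RtoC 0.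

Definition cot (v : R) : R := cos v / sin v.
Definition csc (v : R) : R := / sin v.

Definition t (v : R) : R := - v * csc v * exp (- v * cot v).

(* At v = 0 and v = PI the formulas for t and K divide by zero and give
   arbitrary values; these do not affect the integral over [0, PI]. *)
Definition K (z : C) (v : R) : C :=
  ((1 + z * RtoC (t v)) * RtoC (v ^ 2 + (1 - v * cot v) ^ 2) /
   ((z - RtoC (t v)) * RtoC (1 + t v ^ 2)))%C.

Definition alpha0 (W : C -> C) : R := Re (W Ci).

(* Main.v *)
Require Import Defs.
From Stdlib Require Import Reals Lra Psatz Classical IndefiniteDescription ssreflect.
From Coquelicot Require Import Coquelicot.

(** The function om |-> om exp om maps the region
[range_W = { x + iy : |y| < pi, x > - y cot y }] bijectively onto the plane cut
along (-oo, -1/e], and W is the inverse.  The boundary of the region is the curve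
[bdry v = - v cot v + i v], on which om exp om takes the real value [t v]; so the
integral of the theorem is, up to normalisation, a contour integral along that
boundary, and the theorem is an instance of the argument principle.

Precisely, let z avoid (-oo, 0] and let w in [range_W] satisfy w exp w = z.  The
function [wlogder z w], namely om |-> (om - w) (1 + om) exp om / (om exp om - z),
is (om - w) times the logarithmic derivative of om exp om - z.  By injectivity the
denominator vanishes in the closed region at w only, where the factor om - w
compensates the zero.  Hence the integral over a closed contour in the closed region
vanishes ([contour_zero]).  This is proved by hand: the region is convex, so the
contour can be shrunk to the point w; the derivative of the integral with respect to
the shrinking factor is the integral of an exact form, and the integral tends to 0
with the length of the contour.

The contour consists of the boundary curve over [a <= v <= b], its complex
conjugate, and the two vertical chords joining their ends.  On the two conjugate
curves the factor d(om exp om)/(om exp om - z) is the same, t'(v) dv / (t(v) - z), so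
that only the difference 2 i v of the two factors om - w survives.  The left chord
shrinks to the point -1 as a -> 0.  On the right chord, as b -> pi, the integrand is
om + 1 - w up to O(1/Re om); its integral diverges, but for two points z, z0 the
difference converges to 2 pi i (w0 - w).  This gives [integral_diff]:

   int_0^pi v t'(v) (1/(z - t(v)) - 1/(z0 - t(v))) dv = pi (w - w0).

Since K(z,v) t(v) = v t'(v) (1/(z - t(v)) + t(v)/(1 + t(v)^2)), the left-hand side is
the difference of the integrals of the theorem at z and at z0.  Averaging over z0 = i
and z0 = -i determines the constant: the integrands at i and -i are opposite, and
W(-i) is the conjugate of W(i), so the mean of the two values of W is Re W(i).

That W takes its values in [range_W] ([W_in_range_W]) follows by continuity along the
segment from 0 to z: the path s |-> W(s z) starts at 0 inside the region, and it could
leave the region only through points where om exp om lies on (-oo, 0].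

Finally W(i) = x + i y is determined by x = y tan y and y exp x = cos y.  The
left-hand side of the logarithmic form y tan y + ln y - ln cos y = 0 is increasing in
y, so that Taylor bounds for sin, cos and exp at two rational points enclose y, and
with it x. *)

Open Scope R_scope.

(** * Calculus for complex-valued functions *)

(** Differentiation and continuity of complex-valued functions are taken coordinatewise,
    so that real theorems (mean value, differentiation under the integral sign) apply
    directly. *)
Definition is_cderive (f : R -> C) (x : R) (l : C) : Prop :=
  is_derive (fun u => Re (f u)) x (Re l) /\
  is_derive (fun u => Im (f u)) x (Im l).

Definition ccontinuous {T : UniformSpace} (f : T -> C) (x : T) : Prop :=
  continuous (fun u => Re (f u)) x /\ continuous (fun u => Im (f u)) x.

Lemma is_cderive_const c x : is_cderive (fun _ => c) x 0.
Proof. split; apply: is_derive_const. Qed.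

Lemma is_cderive_RtoC f x l :
  is_derive f x l -> is_cderive (fun u => RtoC (f u)) x (RtoC l).
Proof. intros H; split; [exact H | apply: is_derive_const]. Qed.

Lemma is_cderive_plus f g x l m :
  is_cderive f x l -> is_cderive g x m ->
  is_cderive (fun u => f u + g u)%C x (l + m)%C.
Proof.
  intros [H1 H2] [H3 H4]; split; simpl.
  - exact (is_derive_plus _ _ _ _ _ H1 H3).
  - exact (is_derive_plus _ _ _ _ _ H2 H4).
Qed.

Lemma is_cderive_opp f x l :
  is_cderive f x l -> is_cderive (fun u => - f u)%C x (- l)%C.
Proof.
  intros [H1 H2]; split; simpl.
  - exact (is_derive_opp _ _ _ H1).
  - exact (is_derive_opp _ _ _ H2).
Qed.

Lemma is_cderive_minus f g x l m :
  is_cderive f x l -> is_cderive g x m ->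
  is_cderive (fun u => f u - g u)%C x (l - m)%C.
Proof. intros; apply is_cderive_plus; [|apply is_cderive_opp]; assumption. Qed.

Lemma is_cderive_mult f g x l m :
  is_cderive f x l -> is_cderive g x m ->
  is_cderive (fun u => f u * g u)%C x (l * g x + f x * m)%C.
Proof.
  intros [H1 H2] [H3 H4]; split; unfold Re, Im in *; simpl.
  - evar_last.
    + apply: is_derive_minus;
      (apply: is_derive_mult; [eassumption|eassumption|intros; apply Rmult_comm]).
    + unfold minus, plus, opp, mult; simpl; ring.
  - evar_last.
    + apply: is_derive_plus;
      (apply: is_derive_mult; [eassumption|eassumption|intros; apply Rmult_comm]).
    + unfold minus, plus, opp, mult; simpl; ring.
Qed.

Lemma Csqr_pos (z : C) : z <> 0%C -> 0 < fst z ^ 2 + snd z ^ 2.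
Proof.
  intros Hz. destruct z as [a b]; simpl.
  destruct (Req_dec a 0) as [Ha|Ha]; [|nra].
  destruct (Req_dec b 0) as [Hb|Hb]; [|nra].
  subst; now elim Hz.
Qed.

Lemma is_cderive_inv f x l :
  is_cderive f x l -> f x <> 0%C ->
  is_cderive (fun u => / f u)%C x (- l / (f x * f x))%C.
Proof.
  intros [H1 H2] H. pose proof (Csqr_pos _ H) as Hp.
  unfold Re, Im in *.
  set (a := fun u => fst (f u)) in *. set (b := fun u => snd (f u)) in *.
  split; unfold Re, Im; simpl.
  - change (is_derive (fun u => a u / (a u ^ 2 + b u ^ 2)) x
     (fst (- l / (f x * f x)))%C).
    change (0 < a x ^ 2 + b x ^ 2) in Hp.
    evar_last.
    + apply: is_derive_div; [exact H1| |lra].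
      apply: is_derive_plus; apply: is_derive_pow; eassumption.
    + unfold plus; simpl. fold (a x) (b x). field. nra.
  - change (is_derive (fun u => - b u / (a u ^ 2 + b u ^ 2)) x
     (snd (- l / (f x * f x)))%C).
    change (0 < a x ^ 2 + b x ^ 2) in Hp.
    evar_last.
    + apply: is_derive_div; [apply: is_derive_opp; exact H2| |lra].
      apply: is_derive_plus; apply: is_derive_pow; eassumption.
    + unfold plus, opp; simpl. fold (a x) (b x). field. nra.
Qed.

Lemma is_cderive_div f g x l m :
  is_cderive f x l -> is_cderive g x m -> g x <> 0%C ->
  is_cderive (fun u => f u / g u)%C x ((l * g x - f x * m) / (g x * g x))%C.
Proof.
  intros H1 H2 H.
  replace ((l * g x - f x * m) / (g x * g x))%C
    with (l * / g x + f x * (- m / (g x * g x)))%C by (field; exact H).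
  apply is_cderive_mult; [exact H1|apply is_cderive_inv; assumption].
Qed.

Lemma is_cderive_Cexp f x l :
  is_cderive f x l -> is_cderive (fun u => Cexp (f u)) x (l * Cexp (f x))%C.
Proof.
  intros [H1 H2]; unfold Re, Im in *.
  set (a := fun u => fst (f u)) in *. set (b := fun u => snd (f u)) in *.
  split; unfold Re, Im; simpl.
  - change (is_derive (fun u => exp (a u) * cos (b u)) x
      (fst l * (exp (a x) * cos (b x)) - snd l * (exp (a x) * sin (b x)))).
    evar_last.
    + apply: is_derive_mult.
      * apply: is_derive_comp; [apply is_derive_exp|exact H1].
      * apply: is_derive_comp; [apply is_derive_cos|exact H2].
      * intros; apply Rmult_comm.
    + unfold plus, mult, scal; simpl; unfold mult; simpl. fold (a x) (b x). ring.
  - change (is_derive (fun u => exp (a u) * sin (b u)) x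
      (fst l * (exp (a x) * sin (b x)) + snd l * (exp (a x) * cos (b x)))).
    evar_last.
    + apply: is_derive_mult.
      * apply: is_derive_comp; [apply is_derive_exp|exact H1].
      * apply: is_derive_comp; [apply is_derive_sin|exact H2].
      * intros; apply Rmult_comm.
    + unfold plus, mult, scal; simpl; unfold mult; simpl. fold (a x) (b x). ring.
Qed.

Lemma is_cderive_continuous f x l : is_cderive f x l -> ccontinuous f x.
Proof.
  intros [H1 H2]; split; apply: ex_derive_continuous; eexists; eassumption.
Qed.

Section Continuity.
Context {T : UniformSpace}.
Implicit Types (f g : T -> C) (x : T).

Lemma ccontinuous_ext f g x :
  (forall u, f u = g u) -> ccontinuous f x -> ccontinuous g x.
Proof.
  intros H [H1 H2]; split;
  [apply: continuous_ext H1|apply: continuous_ext H2]; intros u; simpl; now rewrite H.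
Qed.

Lemma ccontinuous_const c x : ccontinuous (fun _ => c) x.
Proof. split; apply continuous_const. Qed.

Lemma ccontinuous_RtoC (f : T -> R) x :
  continuous f x -> ccontinuous (fun u => RtoC (f u)) x.
Proof. intros H; split; [exact H|apply continuous_const]. Qed.

Lemma ccontinuous_plus f g x :
  ccontinuous f x -> ccontinuous g x -> ccontinuous (fun u => f u + g u)%C x.
Proof.
  intros [H1 H2] [H3 H4]; split.
  - exact (continuous_plus _ _ _ H1 H3).
  - exact (continuous_plus _ _ _ H2 H4).
Qed.

Lemma ccontinuous_opp f x :
  ccontinuous f x -> ccontinuous (fun u => - f u)%C x.
Proof.
  intros [H1 H2]; split.
  - exact (continuous_opp _ _ H1).
  - exact (continuous_opp _ _ H2).
Qed.

Lemma ccontinuous_minus f g x :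
  ccontinuous f x -> ccontinuous g x -> ccontinuous (fun u => f u - g u)%C x.
Proof. intros; apply ccontinuous_plus; [|apply ccontinuous_opp]; assumption. Qed.

Lemma ccontinuous_mult f g x :
  ccontinuous f x -> ccontinuous g x -> ccontinuous (fun u => f u * g u)%C x.
Proof.
  intros [H1 H2] [H3 H4]; split.
  - exact (continuous_minus _ _ _ (continuous_mult _ _ _ H1 H3)
             (continuous_mult _ _ _ H2 H4)).
  - exact (continuous_plus _ _ _ (continuous_mult _ _ _ H1 H4)
             (continuous_mult _ _ _ H2 H3)).
Qed.

Lemma ccontinuous_inv f x :
  ccontinuous f x -> f x <> 0%C -> ccontinuous (fun u => / f u)%C x.
Proof.
  intros [H1 H2] H. pose proof (Csqr_pos _ H) as Hp.
  assert (Hd : continuous (fun u => / (Re (f u) * Re (f u) + Im (f u) * Im (f u))) x).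
  { apply (continuous_comp (fun u => Re (f u) * Re (f u) + Im (f u) * Im (f u)) Rinv).
    - exact (continuous_plus _ _ _ (continuous_mult _ _ _ H1 H1)
             (continuous_mult _ _ _ H2 H2)).
    - apply continuous_Rinv. unfold Re, Im; simpl in Hp; simpl; lra. }
  split.
  - apply (continuous_ext
      (fun u => mult (Re (f u)) (/ (Re (f u) * Re (f u) + Im (f u) * Im (f u))))).
    + intros u; unfold mult; simpl; unfold Re, Im; simpl; unfold Rdiv; do 2 f_equal; ring.
    + exact (continuous_mult _ _ _ H1 Hd).
  - apply (continuous_ext
      (fun u => mult (opp (Im (f u))) (/ (Re (f u) * Re (f u) + Im (f u) * Im (f u))))).
    + intros u; unfold mult, opp; simpl; unfold Re, Im; simpl; unfold Rdiv; do 2 f_equal; ring.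
    + exact (continuous_mult _ _ _ (continuous_opp _ _ H2) Hd).
Qed.

Lemma ccontinuous_div f g x :
  ccontinuous f x -> ccontinuous g x -> g x <> 0%C ->
  ccontinuous (fun u => f u / g u)%C x.
Proof. intros; apply ccontinuous_mult; [|apply ccontinuous_inv]; assumption. Qed.

Lemma ccontinuous_Cexp f x :
  ccontinuous f x -> ccontinuous (fun u => Cexp (f u)) x.
Proof.
  intros [H1 H2]; split.
  - exact (continuous_mult (fun u => exp (Re (f u))) (fun u => cos (Im (f u))) x
      (continuous_comp _ exp _ H1 (continuous_exp _)) (continuous_comp _ cos _ H2 (continuous_cos _))).
  - exact (continuous_mult (fun u => exp (Re (f u))) (fun u => sin (Im (f u))) x
      (continuous_comp _ exp _ H1 (continuous_exp _)) (continuous_comp _ sin _ H2 (continuous_sin _))).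
Qed.

End Continuity.

(** The cases are selected by the head symbol: applying the rules blindly makes
    unification unfold the complex operations and diverge. *)
Ltac ccont :=
  repeat match goal with
  | |- ccontinuous (fun u => ?c) _ => apply ccontinuous_const
  | |- ccontinuous (fun u => Cplus _ _) _ => apply ccontinuous_plus
  | |- ccontinuous (fun u => Cminus _ _) _ => apply ccontinuous_minus
  | |- ccontinuous (fun u => Cmult _ _) _ => apply ccontinuous_mult
  | |- ccontinuous (fun u => Cexp _) _ => apply ccontinuous_Cexp
  | |- _ => assumption
  end.

(** * Differentiation of integrals of closed forms *)

(** Tube lemma: by compactness of [a, b], a property that is open around each point of
    {k} x [a, b] holds on a strip of uniform width. *)
Lemma locally_2d_tube (A : R -> R -> Prop) (a b k : R) :
  (forall v, a <= v <= b -> locally_2d A k v) ->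
  locally k (fun u => forall v, a <= v <= b -> A u v).
Proof.
  intros H.
  assert (Hd : forall v, exists d : posreal, a <= v <= b ->
     forall u' v', Rabs (u' - k) < d -> Rabs (v' - v) < d -> A u' v').
  { intros v. destruct (classic (a <= v <= b)) as [Hv|Hv].
    - destruct (H v Hv) as [d Hd]. exists d. auto.
    - exists (mkposreal _ Rlt_0_1). tauto. }
  destruct (IndefiniteDescription.functional_choice _ Hd) as [delta Hdelta].
  destruct (compactness_value_1d a b delta) as [d Hdd].
  exists d. intros u Hu v Hv.
  apply NNPP. intros HA. apply (Hdd v Hv). intros [t [Ht [Htv Hdt]]].
  apply HA. apply (Hdelta t Ht); [|exact Htv].
  change (Rabs (u - k) < d) in Hu. lra.
Qed.

(** If dP/dk = g = dQ/dv, that is, if the form P dv + Q dk is closed, then differentiating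
    the integral of P under the integral sign gives the integral of dQ/dv, which is a
    boundary term.  This is the mechanism behind every deformation of contours here. *)
Lemma is_derive_RInt_exact (P Q g : R -> R -> R) (a b k : R) :
  a <= b ->
  (forall v, a <= v <= b ->
     locally_2d (fun u v => is_derive (fun x => P x v) u (g u v)) k v) ->
  (forall v, a <= v <= b -> continuity_2d_pt g k v) ->
  (forall v, a <= v <= b -> is_derive (fun y => Q k y) v (g k v)) ->
  (forall v, a <= v <= b -> locally_2d (fun u v => continuous (P u) v) k v) ->
  is_derive (fun u => RInt (P u) a b) k (Q k b - Q k a).
Proof.
  intros Hab H1 H2 H3 H4.
  assert (Hmin : Rmin a b = a) by (apply Rmin_left; lra).
  assert (Hmax : Rmax a b = b) by (apply Rmax_right; lra).
  assert (Hg1 : forall v, a <= v <= b -> continuous (g k) v).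
  { intros v Hv. apply continuity_pt_filterlim. intros eps Heps.
    destruct (locally_2d_1d_const_x _ _ _ (H2 v Hv (mkposreal _ Heps))) as [d Hd].
    exists d; split; [apply cond_pos|]. intros y [_ Hy]. now apply Hd. }
  assert (Hint : is_RInt (g k) a b (minus (Q k b) (Q k a))).
  { apply (is_RInt_derive (Q k) (g k)); intros v Hv; rewrite Hmin Hmax in Hv; auto. }
  replace (Q k b - Q k a) with (RInt (fun t => Derive (fun u => P u t) k) a b).
  2:{ apply is_RInt_unique. eapply is_RInt_ext; [|exact Hint].
      intros v Hv. rewrite Hmin Hmax in Hv.
      symmetry. apply is_derive_unique.
      apply (locally_2d_singleton _ _ _ (H1 v ltac:(lra))). }
  apply is_derive_RInt_param.
  - rewrite Hmin Hmax.
    generalize (locally_2d_tube _ a b k H1). apply filter_imp.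
    intros u Hu v Hv. eexists; now apply Hu.
  - rewrite Hmin Hmax. intros v Hv.
    eapply continuity_2d_pt_ext_loc; [|exact (H2 v Hv)].
    generalize (H1 v Hv). apply locally_2d_impl. apply locally_2d_forall.
    intros u' v' Hd. symmetry. now apply is_derive_unique.
  - generalize (locally_2d_tube _ a b k H4). apply filter_imp.
    intros u Hu. apply: ex_RInt_continuous. rewrite Hmin Hmax. exact Hu.
Qed.

Definition CInt (f : R -> C) (a b : R) : C :=
  (RInt (fun v => Re (f v)) a b, RInt (fun v => Im (f v)) a b).

Lemma is_RInt_CInt f a b :
  a <= b -> (forall v, a <= v <= b -> ccontinuous f v) ->
  @is_RInt C_R_NormedModule f a b (CInt f a b).
Proof.
  intros Hab H.
  assert (Hmin : Rmin a b = a) by (apply Rmin_left; lra).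
  assert (Hmax : Rmax a b = b) by (apply Rmax_right; lra).
  apply: is_RInt_fct_extend_pair;
  apply: RInt_correct; apply: ex_RInt_continuous; rewrite Hmin Hmax;
  intros v Hv; apply (H v Hv).
Qed.

Definition ccontinuous2 (g : R -> R -> C) (k v : R) : Prop :=
  ccontinuous (fun p : R * R => g (fst p) (snd p)) (k, v).

Lemma ccontinuous2_Re g k v :
  ccontinuous2 g k v -> continuity_2d_pt (fun k v => Re (g k v)) k v.
Proof. intros [H _]. apply continuity_2d_pt_filterlim. exact H. Qed.
Lemma ccontinuous2_Im g k v :
  ccontinuous2 g k v -> continuity_2d_pt (fun k v => Im (g k v)) k v.
Proof. intros [_ H]. apply continuity_2d_pt_filterlim. exact H. Qed.

Lemma ccontinuous2_neq_0 g k v :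
  ccontinuous2 g k v -> g k v <> 0%C -> locally_2d (fun k v => g k v <> 0%C) k v.
Proof.
  intros H Hn.
  assert (Hc : continuity_2d_pt (fun k v => Re (g k v) * Re (g k v) + Im (g k v) * Im (g k v)) k v).
  { apply continuity_2d_pt_plus; apply continuity_2d_pt_mult;
    (apply ccontinuous2_Re || apply ccontinuous2_Im); exact H. }
  generalize (continuity_2d_pt_neq_0 _ _ _ Hc).
  intros K. pose proof (Csqr_pos _ Hn) as Hp.
  assert (K' : Re (g k v) * Re (g k v) + Im (g k v) * Im (g k v) <> 0).
  { unfold Re, Im. simpl in Hp. lra. }
  generalize (K K'). apply locally_2d_impl. apply locally_2d_forall.
  intros x y Hxy E. apply Hxy. rewrite E. unfold Re, Im; simpl; ring.
Qed.

Lemma is_cderive_CInt_exact (P Q g : R -> R -> C) (a b k : R) :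
  a <= b ->
  (forall v, a <= v <= b ->
     locally_2d (fun u v => is_cderive (fun x => P x v) u (g u v)) k v) ->
  (forall v, a <= v <= b -> ccontinuous2 g k v) ->
  (forall v, a <= v <= b -> is_cderive (fun y => Q k y) v (g k v)) ->
  (forall v, a <= v <= b -> locally_2d (fun u v => ccontinuous (P u) v) k v) ->
  is_cderive (fun u => CInt (P u) a b) k (Q k b - Q k a)%C.
Proof.
  intros Hab H1 H2 H3 H4. split.
  - apply: (is_derive_RInt_exact (fun u v => Re (P u v)) (fun u v => Re (Q u v))
      (fun u v => Re (g u v))); try assumption.
    + intros v Hv. generalize (H1 v Hv). apply locally_2d_impl.
      apply locally_2d_forall. now intros x y [Hx _].
    + intros v Hv. now apply ccontinuous2_Re, H2.
    + intros v Hv. apply H3, Hv.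
    + intros v Hv. generalize (H4 v Hv). apply locally_2d_impl.
      apply locally_2d_forall. now intros x y [Hx _].
  - apply: (is_derive_RInt_exact (fun u v => Im (P u v)) (fun u v => Im (Q u v))
      (fun u v => Im (g u v))); try assumption.
    + intros v Hv. generalize (H1 v Hv). apply locally_2d_impl.
      apply locally_2d_forall. now intros x y [_ Hx].
    + intros v Hv. now apply ccontinuous2_Im, H2.
    + intros v Hv. apply H3, Hv.
    + intros v Hv. generalize (H4 v Hv). apply locally_2d_impl.
      apply locally_2d_forall. now intros x y [_ Hx].
Qed.

Section Homotopy.
Variables z w : C.

Definition den (om : C) : C := (om * Cexp om - z)%C.
(** (om - w) times the logarithmic derivative of om exp om - z. *)
Definition wlogder (om : C) : C := ((om - w) * (1 + om) * Cexp om / den om)%C.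
(** The complex derivative of [wlogder], written with the unreduced quotient rule. *)
Definition dwlogder (om : C) : C :=
  ((((1 + om) * Cexp om + (om - w) * Cexp om + (om - w) * (1 + om) * Cexp om)
     * den om
    - (om - w) * (1 + om) * Cexp om * ((1 + om) * Cexp om))
   / (den om * den om))%C.

Lemma is_cderive_den h x l :
  is_cderive h x l ->
  is_cderive (fun u => den (h u)) x ((1 + h x) * Cexp (h x) * l)%C.
Proof.
  intros H.
  replace ((1 + h x) * Cexp (h x) * l)%C
    with (l * Cexp (h x) + h x * (l * Cexp (h x)) - 0)%C by ring.
  apply is_cderive_minus; [|apply is_cderive_const].
  apply is_cderive_mult; [exact H|]. now apply is_cderive_Cexp.
Qed.

Lemma is_cderive_wlogder h x l :
  is_cderive h x l -> den (h x) <> 0%C ->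
  is_cderive (fun u => wlogder (h u)) x (dwlogder (h x) * l)%C.
Proof.
  intros H Hn.
  replace (dwlogder (h x) * l)%C with
    (((((l - 0) * (1 + h x) + (h x - w) * (0 + l)) * Cexp (h x)
       + (h x - w) * (1 + h x) * (l * Cexp (h x))) * den (h x)
      - (h x - w) * (1 + h x) * Cexp (h x) * ((1 + h x) * Cexp (h x) * l))
     / (den (h x) * den (h x)))%C.
  2:{ unfold dwlogder. field. exact Hn. }
  apply is_cderive_div; [|now apply is_cderive_den|exact Hn].
  apply is_cderive_mult; [|now apply is_cderive_Cexp].
  apply (is_cderive_mult (fun u => h u - w)%C (fun u => 1 + h u)%C).
  - apply is_cderive_minus; [exact H|apply is_cderive_const].
  - apply is_cderive_plus; [apply is_cderive_const|exact H].
Qed.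

Lemma ccontinuous_den {T : UniformSpace} (h : T -> C) x :
  ccontinuous h x -> ccontinuous (fun u => den (h u)) x.
Proof.
  intros H. apply ccontinuous_minus; [|apply ccontinuous_const].
  apply ccontinuous_mult; [exact H|now apply ccontinuous_Cexp].
Qed.

Lemma ccontinuous_wlogder {T : UniformSpace} (h : T -> C) x :
  ccontinuous h x -> den (h x) <> 0%C -> ccontinuous (fun u => wlogder (h u)) x.
Proof.
  intros H Hn. apply ccontinuous_div; [|now apply ccontinuous_den|exact Hn].
  ccont.
Qed.

Lemma ccontinuous_dwlogder {T : UniformSpace} (h : T -> C) x :
  ccontinuous h x -> den (h x) <> 0%C -> ccontinuous (fun u => dwlogder (h u)) x.
Proof.
  intros H Hn. apply ccontinuous_div.
  - assert (Hd := ccontinuous_den h x H). ccont.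
  - apply ccontinuous_mult; now apply ccontinuous_den.
  - now apply Cmult_neq_0.
Qed.

Variables p dp : R -> C.
(** The path p contracted towards w by the factor k. *)
Definition shrink (k v : R) : C := (w + RtoC k * (p v - w))%C.

Lemma is_cderive_shrink_k k v : is_cderive (fun u => shrink u v) k (p v - w)%C.
Proof.
  replace (p v - w)%C with (0 + (RtoC 1 * (p v - w) + RtoC k * 0))%C by ring.
  apply is_cderive_plus; [apply is_cderive_const|].
  apply (is_cderive_mult (fun u => RtoC u) (fun _ => p v - w)%C).
  - apply is_cderive_RtoC. apply: is_derive_id.
  - apply is_cderive_const.
Qed.

Lemma is_cderive_shrink_v k v :
  is_cderive p v (dp v) -> is_cderive (fun u => shrink k u) v (RtoC k * dp v)%C.
Proof.
  intros H.
  replace (RtoC k * dp v)%C with (0 + (0 * (p v - w) + RtoC k * (dp v - 0)))%C by ring.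
  apply is_cderive_plus; [apply is_cderive_const|].
  apply (is_cderive_mult (fun _ => RtoC k) (fun u => p u - w)%C).
  - apply is_cderive_const.
  - apply is_cderive_minus; [exact H|apply is_cderive_const].
Qed.

Lemma ccontinuous_snd (q : R -> C) (k v : R) :
  ccontinuous q v -> ccontinuous (fun x : R * R => q (snd x)) (k, v).
Proof.
  intros [H1 H2]; split;
  [apply (continuous_comp snd (fun y => Re (q y)))|
   apply (continuous_comp snd (fun y => Im (q y)))];
  try (apply continuous_snd); assumption.
Qed.

Lemma ccontinuous2_shrink k v : ccontinuous p v -> ccontinuous2 shrink k v.
Proof.
  intros H.
  apply ccontinuous_plus; [apply ccontinuous_const|].
  apply ccontinuous_mult.
  - apply ccontinuous_RtoC. apply continuous_fst.
  - apply ccontinuous_minus; [now apply ccontinuous_snd|apply ccontinuous_const].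
Qed.

Definition arc_integral (a b k : R) : C :=
  CInt (fun v => wlogder (shrink k v) * (RtoC k * dp v))%C a b.

(** With om = w + k (p v - w), the form wlogder(om) d(om) is closed in the variables (k, v)
    because wlogder is holomorphic; its dv-component is the integrand and its
    dk-component is wlogder(om) (p v - w).  For consecutive arcs of a closed contour the
    boundary terms cancel. *)
Lemma is_cderive_arc_integral (a b k : R) :
  a <= b ->
  (forall v, a <= v <= b ->
     locally v (fun v' => is_cderive p v' (dp v') /\ ccontinuous dp v')) ->
  (forall v, a <= v <= b -> den (shrink k v) <> 0%C) ->
  is_cderive (arc_integral a b) k
    (wlogder (shrink k b) * (p b - w) - wlogder (shrink k a) * (p a - w))%C.
Proof.
  intros Hab Hp Hn.
  assert (Hloc : forall v, a <= v <= b -> locally_2d (fun k' v' =>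
      den (shrink k' v') <> 0%C /\ is_cderive p v' (dp v') /\ ccontinuous dp v') k v).
  { intros v Hv. apply locally_2d_and.
    - apply (ccontinuous2_neq_0 (fun k v => den (shrink k v))); [|now apply Hn].
      apply ccontinuous_den.
      apply ccontinuous2_shrink.
      exact (is_cderive_continuous _ _ _ (proj1 (locally_singleton _ _ (Hp v Hv)))).
    - destruct (Hp v Hv) as [d Hd]. exists d. intros u' v' _ Hv'. apply Hd. exact Hv'. }
  apply (is_cderive_CInt_exact (fun k v => wlogder (shrink k v) * (RtoC k * dp v))%C
    (fun k v => wlogder (shrink k v) * (p v - w))%C
    (fun k v => dwlogder (shrink k v) * (p v - w) * (RtoC k * dp v) + wlogder (shrink k v) * dp v)%C).
  - exact Hab.
  - intros v Hv. generalize (Hloc v Hv). apply locally_2d_impl, locally_2d_forall.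
    intros k' v' [H1 [H2 H3]].
    replace (wlogder (shrink k' v') * dp v')%C
      with (wlogder (shrink k' v') * (RtoC 1 * dp v' + RtoC k' * 0))%C by ring.
    apply (is_cderive_mult (fun k => wlogder (shrink k v')) (fun k => RtoC k * dp v')%C).
    + apply (is_cderive_wlogder (fun k => shrink k v')); [|exact H1]. apply is_cderive_shrink_k.
    + apply (is_cderive_mult (fun u => RtoC u) (fun _ => dp v')).
      * apply is_cderive_RtoC. apply: is_derive_id.
      * apply is_cderive_const.
  - intros v Hv. destruct (locally_2d_singleton _ _ _ (Hloc v Hv)) as [H1 [H2 H3]].
    pose proof (ccontinuous2_shrink k v (is_cderive_continuous _ _ _ H2)) as Hh.
    pose proof (is_cderive_continuous _ _ _ H2) as Hpc.
    apply ccontinuous_plus; [apply ccontinuous_mult; [apply ccontinuous_mult|apply ccontinuous_mult]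
      |apply ccontinuous_mult].
    + now apply (ccontinuous_dwlogder (fun q : R * R => shrink (fst q) (snd q))).
    + apply ccontinuous_minus; [now apply ccontinuous_snd|apply ccontinuous_const].
    + apply ccontinuous_RtoC. apply continuous_fst.
    + now apply ccontinuous_snd.
    + now apply (ccontinuous_wlogder (fun q : R * R => shrink (fst q) (snd q))).
    + now apply ccontinuous_snd.
  - intros v Hv. destruct (locally_2d_singleton _ _ _ (Hloc v Hv)) as [H1 [H2 H3]].
    replace (dwlogder (shrink k v) * (p v - w) * (RtoC k * dp v) + wlogder (shrink k v) * dp v)%C
      with (dwlogder (shrink k v) * (RtoC k * dp v) * (p v - w) + wlogder (shrink k v) * (dp v - 0))%C by ring.
    apply (is_cderive_mult (fun v => wlogder (shrink k v)) (fun v => p v - w)%C).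
    + apply (is_cderive_wlogder (fun v => shrink k v)); [|exact H1]. now apply is_cderive_shrink_v.
    + apply is_cderive_minus; [exact H2|apply is_cderive_const].
  - intros v Hv. generalize (Hloc v Hv). apply locally_2d_impl, locally_2d_forall.
    intros k' v' [H1 [H2 H3]].
    apply ccontinuous_mult.
    + apply (ccontinuous_wlogder (fun v => shrink k' v)); [|exact H1].
      eapply is_cderive_continuous, is_cderive_shrink_v, H2.
    + apply ccontinuous_mult; [apply ccontinuous_const|exact H3].
Qed.

End Homotopy.

(** * The function y cot y *)

Lemma MVT_open (f df : R -> R) (a b : R) :
  a < b -> (forall x, a <= x <= b -> is_derive f x (df x)) ->
  exists c, f b - f a = df c * (b - a) /\ a < c < b.
Proof.
  intros Hab H. apply MVT_cor2; [exact Hab|].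
  intros c Hc. apply is_derive_Reals. auto.
Qed.

Lemma sin_minus_xcos_pos x : 0 < x < PI -> x * cos x < sin x.
Proof.
  intros Hx.
  destruct (MVT_open (fun u => sin u - u * cos u) (fun u => u * sin u) 0 x)
    as [c [E Hc]]; [lra| |].
  - intros u _. auto_derive; [trivial|ring].
  - rewrite sin_0 in E.
    assert (0 < c * sin c) by (apply Rmult_lt_0_compat; [lra|apply sin_gt_0; lra]).
    assert (0 < c * sin c * (x - 0)) by (apply Rmult_lt_0_compat; lra).
    lra.
Qed.

(** The function y cot y with its removable singularity at 0 filled in; the graph
    x = - ycot y is the boundary of [range_W]. *)
Definition ycot (y : R) : R := if Req_dec_T y 0 is left _ then 1 else y * cos y / sin y.

Lemma ycot_0 : ycot 0 = 1.
Proof. unfold ycot. destruct (Req_dec_T 0 0); lra. Qed.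

Lemma ycot_neq y : y <> 0 -> ycot y = y * cos y / sin y.
Proof. intros H. unfold ycot. destruct (Req_dec_T y 0); [contradiction|reflexivity]. Qed.

Lemma ycot_opp y : ycot (- y) = ycot y.
Proof.
  destruct (Req_dec y 0) as [->|H]; [now rewrite Ropp_0|].
  rewrite !ycot_neq; [|lra|lra]. rewrite cos_neg sin_neg.
  unfold Rdiv. rewrite Rinv_opp. ring.
Qed.

Lemma ycot_abs y : ycot (Rabs y) = ycot y.
Proof. unfold Rabs. destruct (Rcase_abs y); [apply ycot_opp|reflexivity]. Qed.

Definition dycot (y : R) : R := cos y / sin y - y / sin y ^ 2.

Lemma is_derive_ycot y : 0 < y < PI -> is_derive ycot y (dycot y).
Proof.
  intros Hy. pose proof (sin_gt_0 y ltac:(lra) ltac:(lra)).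
  apply (is_derive_ext_loc (fun u => u * cos u / sin u)).
  - exists (mkposreal y ltac:(lra)). intros u Hu. change (Rabs (u - y) < y) in Hu.
    rewrite ycot_neq; [reflexivity|]. intros ->.
    rewrite Rabs_left in Hu; lra.
  - auto_derive; [lra|]. unfold dycot.
    pose proof (sin2_cos2 y) as E. unfold Rsqr in E.
    field_simplify_eq; [|lra]. simpl. nra.
Qed.

Lemma ycot_lt_1 y : 0 < y < PI -> ycot y < 1.
Proof.
  intros Hy. pose proof (sin_gt_0 y ltac:(lra) ltac:(lra)).
  rewrite ycot_neq; [|lra]. apply Rlt_div_l; [lra|].
  rewrite Rmult_1_l. now apply sin_minus_xcos_pos.
Qed.

Lemma dycot_neg y : 0 < y < PI -> dycot y < 0.
Proof.
  intros Hy. pose proof (sin_gt_0 y ltac:(lra) ltac:(lra)).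
  unfold dycot.
  replace (cos y / sin y - y / sin y ^ 2) with (- ((y - sin y * cos y) / sin y ^ 2)) by (field; lra).
  apply Ropp_lt_gt_0_contravar. apply Rdiv_lt_0_compat; [|apply pow_lt; lra].
  pose proof (sin_lt_x y ltac:(lra)). pose proof (COS_bound y). nra.
Qed.

(** The second derivative of y cot y is - (2 / sin^2 y) (1 - y cot y) <= 0. *)
Lemma dycot_decr x y : 0 < x -> x <= y -> y < PI -> dycot y <= dycot x.
Proof.
  intros Hx [Hxy|<-] Hy; [|lra].
  destruct (MVT_open dycot (fun u => - (2 / sin u ^ 2 * (1 - ycot u))) x y)
    as [c [E Hc]]; [lra| |].
  - intros u Hu. pose proof (sin_gt_0 u ltac:(lra) ltac:(lra)).
    unfold dycot. auto_derive.
    + repeat split; nra.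
    + rewrite ycot_neq; [|lra].
      pose proof (sin2_cos2 u) as E. unfold Rsqr in E.
      field_simplify_eq; [|lra].
      replace (sin u ^ 4) with (sin u ^ 2 * (1 - cos u * cos u)) by (rewrite -E; ring).
      ring.
  - pose proof (sin_gt_0 c ltac:(lra) ltac:(lra)).
    pose proof (ycot_lt_1 c ltac:(lra)).
    assert (0 <= 2 / sin c ^ 2 * (1 - ycot c)).
    { apply Rmult_le_pos; [|lra]. left. apply Rdiv_lt_0_compat; [lra|apply pow_lt; lra]. }
    assert (0 <= 2 / sin c ^ 2 * (1 - ycot c) * (y - x)) by (apply Rmult_le_pos; lra).
    lra.
Qed.

(** Concavity of y cot y on (-pi, pi), as existence of a supporting line at each point.  On
    the positive side it is the tangent; this line also lies above the graph on the
    negative side because the function is even and the slope is negative. *)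
Lemma ycot_support a : -PI < a < PI ->
  exists m, forall y, -PI < y < PI -> ycot y <= ycot a + m * (y - a).
Proof.
  assert (Hpos : forall a y, 0 < a < PI -> 0 <= y < PI ->
     ycot y <= ycot a + dycot a * (y - a)).
  { clear a. intros a y Ha Hy.
    destruct (Req_dec y 0) as [->|Hy0].
    - rewrite ycot_0 ycot_neq; [|lra]. unfold dycot.
      pose proof (sin_gt_0 a ltac:(lra) ltac:(lra)).
      replace (a * cos a / sin a + (cos a / sin a - a / sin a ^ 2) * (0 - a))
        with (a ^ 2 / sin a ^ 2) by (field; lra).
      apply Rle_div_r; [apply pow_lt; lra|].
      pose proof (sin_lt_x a ltac:(lra)). nra.
    - destruct (Rtotal_order y a) as [H|[->|H]]; [|lra|].
      + destruct (MVT_open ycot dycot y a) as [c [E Hc]]; [lra| |].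
        { intros u Hu. apply is_derive_ycot. lra. }
        pose proof (dycot_decr c a ltac:(lra) ltac:(lra) ltac:(lra)). nra.
      + destruct (MVT_open ycot dycot a y) as [c [E Hc]]; [lra| |].
        { intros u Hu. apply is_derive_ycot. lra. }
        pose proof (dycot_decr a c ltac:(lra) ltac:(lra) ltac:(lra)). nra. }
  assert (Hall : forall a y, 0 < a < PI -> - PI < y < PI ->
     ycot y <= ycot a + dycot a * (y - a)).
  { clear a. intros a y Ha Hy.
    rewrite -(ycot_abs y).
    assert (0 <= Rabs y < PI) by (split; [apply Rabs_pos|apply Rabs_def1; lra]).
    pose proof (Hpos a (Rabs y) Ha H). pose proof (dycot_neg a Ha).
    pose proof (Rle_abs y). nra. }
  intros Ha. destruct (Rtotal_order a 0) as [H|[->|H]].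
  - exists (- dycot (- a)). intros y Hy.
    pose proof (Hall (- a) (- y) ltac:(lra) ltac:(lra)) as K.
    rewrite !ycot_opp in K. lra.
  - exists 0. intros y Hy. rewrite ycot_0 -ycot_abs.
    destruct (Req_dec y 0) as [->|Hy0]; [rewrite Rabs_R0 ycot_0; lra|].
    pose proof (Rabs_pos_lt y Hy0).
    assert (Rabs y < PI) by (apply Rabs_def1; lra).
    pose proof (ycot_lt_1 (Rabs y) ltac:(lra)). lra.
  - exists (dycot a). intros y Hy. apply Hall; lra.
Qed.

Lemma ycot_concave k x y : 0 <= k <= 1 -> -PI < x < PI -> -PI < y < PI ->
  (1 - k) * ycot x + k * ycot y <= ycot (x + k * (y - x)).
Proof.
  intros Hk Hx Hy.
  destruct (ycot_support (x + k * (y - x))) as [m Hm].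
  { destruct (Rle_lt_dec x y); split; nra. }
  pose proof (Hm x Hx) as K1. pose proof (Hm y Hy) as K2.
  set (L := ycot (x + k * (y - x))) in *. nra.
Qed.

Lemma ycot_decr x y : 0 <= x -> x < y -> y < PI -> ycot y < ycot x.
Proof.
  intros Hx Hxy Hy. destruct (Req_dec x 0) as [->|Hx0].
  - rewrite ycot_0. apply ycot_lt_1; lra.
  - destruct (MVT_open ycot dycot x y) as [c [E Hc]]; [lra| |].
    { intros u Hu. apply is_derive_ycot. lra. }
    pose proof (dycot_neg c ltac:(lra)). nra.
Qed.

Lemma ycot_le_1 y : -PI < y < PI -> ycot y <= 1.
Proof.
  intros Hy. rewrite -ycot_abs.
  assert (0 <= Rabs y < PI) by (split; [apply Rabs_pos|apply Rabs_def1; lra]).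
  destruct (Req_dec (Rabs y) 0) as [->|Hy0]; [rewrite ycot_0; lra|].
  pose proof (ycot_lt_1 (Rabs y) ltac:(lra)). lra.
Qed.

(** * The range of the principal branch *)

(** The range of the principal branch of W. *)
Definition range_W (om : C) : Prop :=
  -PI < Im om < PI /\ - ycot (Im om) < Re om.

Lemma C_ext (a b : C) : Re a = Re b -> Im a = Im b -> a = b.
Proof. destruct a, b; simpl; intros -> ->; reflexivity. Qed.

(** Polar form in the upper half plane, with the angle psi measured from the imaginary
    axis, so that it is an arc tangent without case distinctions. *)
Lemma polar_up x y : 0 < y ->
  let psi := atan (x / y) in
  - PI / 2 < psi < PI / 2 /\ 0 < cos psi /\ x = y * (sin psi / cos psi).
Proof.
  intros Hy psi. pose proof (atan_bound (x / y)) as Hb.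
  assert (Hc : 0 < cos psi) by (apply cos_gt_0; unfold psi; lra).
  split; [unfold psi; lra|split; [exact Hc|]].
  change (sin psi / cos psi) with (tan psi). unfold psi. rewrite tan_atan. field. lra.
Qed.

(** The argument of om exp om, measured from the imaginary axis like psi, is y - psi. *)
Lemma mulexp_up x y : 0 < y ->
  let psi := atan (x / y) in
  ((x, y) * Cexp (x, y))%C =
  (- (exp x * (y / cos psi) * sin (y - psi)), exp x * (y / cos psi) * cos (y - psi)).
Proof.
  intros Hy psi. destruct (polar_up x y Hy) as [_ [Hc Hx]]. fold psi in Hc, Hx.
  unfold Cexp. change (Re (x, y)) with x. change (Im (x, y)) with y.
  set (e := exp x). rewrite sin_minus cos_minus.
  apply C_ext; unfold Re, Im; simpl; rewrite Hx; field; lra.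
Qed.

(** In the upper half plane, [range_W] is where the argument y + arg om of om exp om is less
    than pi. *)
Lemma range_W_up x y : 0 < y ->
  (range_W (x, y) <-> y - atan (x / y) < PI / 2).
Proof.
  intros Hy. pose proof (atan_bound (x / y)) as Hb. unfold range_W, Re, Im; simpl.
  assert (Htan : y < PI -> tan (y - PI / 2) = - (cos y / sin y)).
  { intros H. pose proof (sin_gt_0 y Hy H).
    unfold tan. rewrite sin_minus cos_minus sin_PI2 cos_PI2. field. lra. }
  split.
  - intros [Hpi Hx]. rewrite ycot_neq in Hx; [|lra].
    pose proof (sin_gt_0 y Hy ltac:(lra)).
    assert (K : tan (y - PI / 2) < x / y).
    { rewrite Htan; [|lra]. apply Rlt_div_r; [lra|].
      replace (- (cos y / sin y) * y) with (- (y * cos y / sin y)) by (field; lra). exact Hx. }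
    apply atan_increasing in K. rewrite atan_tan in K; lra.
  - intros H. assert (Hpi : y < PI) by lra.
    pose proof (sin_gt_0 y Hy ltac:(lra)).
    split; [lra|]. rewrite ycot_neq; [|lra].
    assert (K : tan (y - PI / 2) < tan (atan (x / y))) by (apply tan_increasing; lra).
    rewrite tan_atan Htan in K; [|lra].
    apply (Rmult_lt_compat_r y) in K; [|lra].
    replace (x / y * y) with x in K by (field; lra).
    replace (- (cos y / sin y) * y) with (- (y * cos y / sin y)) in K by (field; lra). exact K.
Qed.

(** ln |om exp om| along the curve where the argument of om exp om is constant, equal to
    d + pi/2; on that curve psi = u - d is determined by the ordinate u. *)
Definition logmod (d u : R) : R := u * (sin (u - d) / cos (u - d)) + ln u - ln (cos (u - d)).

(** The derivative is |1 + om|^2 / u, since d(ln(om exp om)) = (1 + om)/om d(om) is real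
    along the curve. *)
Lemma logmod_incr d y1 y2 : 0 < y1 -> y1 < y2 ->
  (forall u, y1 <= u <= y2 -> 0 < cos (u - d)) ->
  logmod d y1 < logmod d y2.
Proof.
  intros H1 H12 Hc.
  destruct (MVT_open (logmod d)
    (fun u => ((1 + u * (sin (u - d) / cos (u - d))) ^ 2 + u ^ 2) / u) y1 y2)
    as [c [E Hcc]]; [lra| |].
  - intros u Hu. pose proof (Hc u Hu) as K. unfold logmod.
    auto_derive.
    + change (u + - d) with (u - d). repeat split; lra.
    + change (u + - d) with (u - d).
      pose proof (sin2_cos2 (u - d)) as E. unfold Rsqr in E.
      set (s := sin (u - d)) in *. set (k := cos (u - d)) in *.
      field_simplify_eq; [|lra].
      replace (s ^ 2) with (1 - k * k) by (rewrite -E; ring).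
      ring.
  - assert (0 < ((1 + c * (sin (c - d) / cos (c - d))) ^ 2 + c ^ 2) / c).
    { apply Rdiv_lt_0_compat; [|lra]. 
      pose proof (pow2_ge_0 (1 + c * (sin (c - d) / cos (c - d)))). nra. }
    assert (0 < ((1 + c * (sin (c - d) / cos (c - d))) ^ 2 + c ^ 2) / c * (y2 - y1))
      by (apply Rmult_lt_0_compat; lra). lra.
Qed.

(** Equal values of om exp om have equal arguments, which puts the two points on the same
    curve of constant argument; there the modulus is strictly monotone. *)
Lemma mulexp_inj_up x1 y1 x2 y2 : 0 < y1 -> 0 < y2 ->
  range_W (x1, y1) -> range_W (x2, y2) ->
  ((x1, y1) * Cexp (x1, y1))%C = ((x2, y2) * Cexp (x2, y2))%C ->
  (x1, y1) = (x2, y2) :> C.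
Proof.
  intros H1 H2 D1 D2 E.
  apply range_W_up in D1; [|exact H1]. apply range_W_up in D2; [|exact H2].
  rewrite (mulexp_up x1 y1 H1) (mulexp_up x2 y2 H2) in E.
  destruct (polar_up x1 y1 H1) as [B1 [C1 X1]].
  destruct (polar_up x2 y2 H2) as [B2 [C2 X2]].
  set (p1 := atan (x1 / y1)) in *. set (p2 := atan (x2 / y2)) in *.
  assert (P1 : 0 < exp x1 * (y1 / cos p1)).
  { apply Rmult_lt_0_compat; [apply exp_pos|apply Rdiv_lt_0_compat; lra]. }
  assert (P2 : 0 < exp x2 * (y2 / cos p2)).
  { apply Rmult_lt_0_compat; [apply exp_pos|apply Rdiv_lt_0_compat; lra]. }
  assert (K1 : 0 < cos (y1 - p1)) by (apply cos_gt_0; lra).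
  assert (K2 : 0 < cos (y2 - p2)) by (apply cos_gt_0; lra).
  injection E as ER EI.
  set (m1 := exp x1 * (y1 / cos p1)) in *. set (m2 := exp x2 * (y2 / cos p2)) in *.
  assert (Hd : y1 - p1 = y2 - p2).
  { apply tan_inj; try lra. unfold tan.
    replace (sin (y1 - p1) / cos (y1 - p1)) with (m1 * sin (y1 - p1) / (m1 * cos (y1 - p1)))
      by (field; lra).
    replace (sin (y2 - p2) / cos (y2 - p2)) with (m2 * sin (y2 - p2) / (m2 * cos (y2 - p2)))
      by (field; lra).
    rewrite EI. f_equal. lra. }
  assert (Hm : m1 = m2).
  { rewrite Hd in EI. apply Rmult_eq_reg_r in EI; [exact EI|lra]. }
  set (d := y2 - p2) in *.
  assert (E1 : p1 = y1 - d) by lra. assert (E2 : p2 = y2 - d) by (unfold d; lra).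
  assert (HL : forall x y p, 0 < y -> 0 < cos p -> x = y * (sin p / cos p) -> p = y - d ->
     ln (exp x * (y / cos p)) = logmod d y).
  { intros x y p Hy Hc Hx Hp. unfold logmod. rewrite -Hp -Hx.
    rewrite ln_mult; [|apply exp_pos|apply Rdiv_lt_0_compat; lra].
    rewrite ln_exp ln_div; [lra|lra|lra]. }
  assert (Hy : y1 = y2).
  { pose proof (HL x1 y1 p1 H1 C1 X1 E1) as L1.
    pose proof (HL x2 y2 p2 H2 C2 X2 E2) as L2.
    fold m1 in L1. fold m2 in L2. rewrite Hm L2 in L1.
    destruct (Rtotal_order y1 y2) as [H|[H|H]]; [exfalso|exact H|exfalso].
    - assert (logmod d y1 < logmod d y2); [|lra].
      apply logmod_incr; [lra|lra|]. intros u Hu. apply cos_gt_0; lra.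
    - assert (logmod d y2 < logmod d y1); [|lra].
      apply logmod_incr; [lra|lra|]. intros u Hu. apply cos_gt_0; lra. }
  rewrite X1 X2 E1 E2 Hy. reflexivity.
Qed.

Lemma mulexp_conj om : (Cconj om * Cexp (Cconj om))%C = Cconj (om * Cexp om)%C.
Proof.
  destruct om as [x y]. apply C_ext; unfold Re, Im; simpl; rewrite cos_neg sin_neg; ring.
Qed.

Lemma range_W_conj om : range_W om -> range_W (Cconj om).
Proof.
  destruct om as [x y]. unfold range_W, Re, Im; simpl. rewrite ycot_opp. lra.
Qed.

Lemma mulexp_Im_up om : range_W om -> 0 < Im om -> 0 < Im (om * Cexp om)%C.
Proof.
  destruct om as [x y]. change (Im (x, y)) with y. intros HD Hy.
  apply range_W_up in HD; [|exact Hy]. rewrite (mulexp_up x y Hy).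
  destruct (polar_up x y Hy) as [B [Cp _]].
  change (0 < exp x * (y / cos (atan (x / y))) * cos (y - atan (x / y))).
  apply Rmult_lt_0_compat; [|apply cos_gt_0; lra].
  apply Rmult_lt_0_compat; [apply exp_pos|apply Rdiv_lt_0_compat; lra].
Qed.

Lemma mulexp_Im_down om : range_W om -> Im om < 0 -> Im (om * Cexp om)%C < 0.
Proof.
  intros HD Hy. pose proof (mulexp_Im_up (Cconj om) (range_W_conj _ HD)) as K.
  rewrite mulexp_conj in K.
  assert (H : 0 < Im (Cconj om)) by (destruct om; unfold Im in *; simpl in *; lra).
  apply K in H. change (0 < - Im (om * Cexp om)%C) in H. lra.
Qed.

Lemma mulexp_Im_0 om : Im om = 0 ->
  (om * Cexp om)%C = RtoC (Re om * exp (Re om)).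
Proof.
  destruct om as [x y]. unfold Im; simpl. intros ->.
  apply C_ext; unfold Re, Im; simpl; rewrite cos_0 sin_0; ring.
Qed.

(** The sign of Im (om exp om) on [range_W] is that of Im om, which reduces injectivity to
    the upper half plane, by conjugation, and to the positive real axis. *)
Lemma mulexp_inj om1 om2 :
  range_W om1 -> range_W om2 -> ~ on_cut 0 (om1 * Cexp om1)%C ->
  (om1 * Cexp om1)%C = (om2 * Cexp om2)%C -> om1 = om2.
Proof.
  intros D1 D2 Hcut E.
  destruct (Rtotal_order (Im om1) 0) as [H1|[H1|H1]];
  destruct (Rtotal_order (Im om2) 0) as [H2|[H2|H2]];
  try (exfalso;
    repeat match goal with
    | D : range_W ?o, H : Im ?o < 0 |- _ =>
        pose proof (mulexp_Im_down o D H); clear H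
    | D : range_W ?o, H : Im ?o = 0 |- _ =>
        pose proof (f_equal Im (mulexp_Im_0 o H)); clear H
    | D : range_W ?o, H : Im ?o > 0 |- _ =>
        pose proof (mulexp_Im_up o D H); clear H
    end; rewrite -> E in *; unfold Im, RtoC in *; simpl in *; lra).
  - rewrite -(Cconj_conj om1) -(Cconj_conj om2). f_equal.
    destruct om1 as [x1 y1], om2 as [x2 y2]. unfold Im in H1, H2; simpl in H1, H2.
    apply (mulexp_inj_up x1 (- y1) x2 (- y2)); try lra.
    + exact (range_W_conj _ D1).
    + exact (range_W_conj _ D2).
    + transitivity (Cconj ((x1, y1) * Cexp (x1, y1))%C); [exact (mulexp_conj (x1, y1))|].
      rewrite E. symmetry. exact (mulexp_conj (x2, y2)).
  - assert (K : Re om1 * exp (Re om1) = Re om2 * exp (Re om2)).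
    { rewrite (mulexp_Im_0 om1 H1) (mulexp_Im_0 om2 H2) in E.
      injection E. trivial. }
    assert (P : 0 < Re om1 * exp (Re om1)).
    { apply Rnot_le_lt. intros P. apply Hcut. rewrite (mulexp_Im_0 om1 H1).
      split; [reflexivity|exact P]. }
    pose proof (exp_pos (Re om1)). pose proof (exp_pos (Re om2)).
    assert (0 < Re om1) by nra. assert (0 < Re om2) by nra.
    apply C_ext; [|lra].
    destruct (Rtotal_order (Re om1) (Re om2)) as [H'|[H'|H']]; [exfalso|exact H'|exfalso].
    + pose proof (exp_increasing _ _ H'). nra.
    + pose proof (exp_increasing _ _ H'). nra.
  - destruct om1 as [x1 y1], om2 as [x2 y2]. now apply mulexp_inj_up.
Qed.

(** [range_W] is the strict epigraph of - y cot y over the strip, and y cot y is concave;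
    strictness survives as long as w has a positive share in the combination. *)
Lemma range_W_convex w p k : range_W w -> -PI < Im p < PI -> - ycot (Im p) <= Re p ->
  0 <= k < 1 -> range_W (w + RtoC k * (p - w))%C.
Proof.
  intros [W1 W2] P1 P2 Hk.
  assert (EI : Im (w + RtoC k * (p - w))%C = Im w + k * (Im p - Im w)).
  { destruct w, p; unfold Im; simpl; ring. }
  assert (ER : Re (w + RtoC k * (p - w))%C = Re w + k * (Re p - Re w)).
  { destruct w, p; unfold Re; simpl; ring. }
  unfold range_W. rewrite EI ER. split.
  - destruct (Rle_lt_dec (Im w) (Im p)); split; nra.
  - pose proof (ycot_concave k (Im w) (Im p) ltac:(lra) W1 P1).
    set (L := ycot (Im w + k * (Im p - Im w))) in *. nra.
Qed.

(** The upper half of the boundary of [range_W], traversed by W on the upper side of the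
    cut. *)
Definition bdry (v : R) : C := (- ycot v, v).
Definition dbdry (v : R) : C := (- dycot v, 1).
(** The derivative of [t]. *)
Definition dt (v : R) : R := t v * (v ^ 2 + (1 - v * cot v) ^ 2) / v.

Lemma bdry_mulexp v : 0 < v < PI -> (bdry v * Cexp (bdry v))%C = RtoC (t v).
Proof.
  intros Hv. pose proof (sin_gt_0 v ltac:(lra) ltac:(lra)).
  unfold bdry, t, cot, csc. rewrite ycot_neq; [|lra].
  replace (- v * (cos v / sin v)) with (- (v * cos v / sin v)) by (field; lra).
  pose proof (sin2_cos2 v) as E. unfold Rsqr in E.
  apply C_ext; unfold Re, Im; simpl; set (e := exp _).
  - field_simplify_eq; [|lra].
    replace (sin v ^ 2) with (1 - cos v * cos v) by (rewrite -E; ring). ring.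
  - field. lra.
Qed.

Lemma bdry_dt v : 0 < v < PI ->
  ((1 + bdry v) * Cexp (bdry v) * dbdry v)%C = RtoC (dt v).
Proof.
  intros Hv. pose proof (sin_gt_0 v ltac:(lra) ltac:(lra)).
  unfold dt, bdry, dbdry, t, cot, csc, dycot. rewrite ycot_neq; [|lra].
  replace (- v * (cos v / sin v)) with (- (v * cos v / sin v)) by (field; lra).
  pose proof (sin2_cos2 v) as E. unfold Rsqr in E.
  assert (E2 : cos v ^ 2 = 1 - sin v ^ 2) by (rewrite -E; ring).
  apply C_ext; unfold Re, Im; simpl; set (e := exp _).
  - field_simplify_eq; [|lra].
    replace (cos v ^ 4) with ((1 - sin v ^ 2) * (1 - sin v ^ 2)) by (rewrite -E2; ring).
    replace (cos v ^ 3) with (cos v * (1 - sin v ^ 2)) by (rewrite -E2; ring).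
    rewrite E2. ring.
  - field_simplify_eq; [|lra].
    replace (cos v ^ 3) with (cos v * (1 - sin v ^ 2)) by (rewrite -E2; ring).
    rewrite E2. ring.
Qed.

Lemma t_neg v : 0 < v < PI -> t v < 0.
Proof.
  intros Hv. pose proof (sin_gt_0 v ltac:(lra) ltac:(lra)).
  unfold t, csc. pose proof (exp_pos (- v * cot v)).
  assert (0 < v * / sin v) by (apply Rdiv_lt_0_compat; lra). nra.
Qed.

Lemma is_cderive_bdry v : 0 < v < PI -> is_cderive bdry v (dbdry v).
Proof.
  intros Hv. split; unfold bdry, dbdry, Re, Im; simpl.
  - apply: is_derive_opp. now apply is_derive_ycot.
  - apply: is_derive_id.
Qed.

Lemma continuous_dycot v : 0 < v < PI -> continuous dycot v.
Proof.
  intros Hv. pose proof (sin_gt_0 v ltac:(lra) ltac:(lra)).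
  apply: ex_derive_continuous. unfold dycot. auto_derive. repeat split; nra.
Qed.

Lemma ccontinuous_dbdry v : 0 < v < PI -> ccontinuous dbdry v.
Proof.
  intros Hv. split; unfold dbdry, Re, Im; simpl.
  - apply: continuous_opp. now apply continuous_dycot.
  - apply continuous_const.
Qed.

(** * Estimates *)

Lemma norm_Cmod (x : C) : @norm R_AbsRing C_R_NormedModule x = Cmod x.
Proof.
  destruct x as [a b]. unfold Cmod.
  change (sqrt (Rabs a ^ 2 + Rabs b ^ 2) = sqrt (a ^ 2 + b ^ 2)).
  f_equal. rewrite -!Rsqr_pow2 -!Rsqr_abs. reflexivity.
Qed.

Lemma Cmod_CInt_le f a b M :
  a <= b -> (forall v, a <= v <= b -> ccontinuous f v) ->
  (forall v, a <= v <= b -> Cmod (f v) <= M) ->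
  Cmod (CInt f a b) <= (b - a) * M.
Proof.
  intros Hab Hc HM. rewrite -norm_Cmod.
  apply (norm_RInt_le_const f a b (CInt f a b) M Hab).
  - intros v Hv. rewrite norm_Cmod. auto.
  - now apply is_RInt_CInt.
Qed.

Lemma ccontinuous_bounded f a b :
  a <= b -> (forall v, a <= v <= b -> ccontinuous f v) ->
  exists M, 0 < M /\ forall v, a <= v <= b -> Cmod (f v) <= M.
Proof.
  intros Hab Hc.
  destruct (@ex_RInt_ub C_R_NormedModule f a b) as [M HM].
  - exists (CInt f a b). now apply is_RInt_CInt.
  - exists (Rabs M + 1). split; [pose proof (Rabs_pos M); lra|].
    intros v Hv. rewrite -norm_Cmod. pose proof (Rle_abs M).
    rewrite Rmin_left in HM; [|lra]. rewrite Rmax_right in HM; [|lra].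
    specialize (HM v Hv). lra.
Qed.

Lemma Cmod_le_Rabs x : Cmod x <= Rabs (Re x) + Rabs (Im x).
Proof.
  destruct x as [a b].
  replace (a, b) with (RtoC a + Ci * RtoC b)%C.
  - eapply Rle_trans; [apply Cmod_triangle|].
    rewrite Cmod_mult Cmod_Ci !Cmod_R. unfold Re, Im; simpl.
    rewrite ?Rmult_1_l ?Rmult_0_l ?Rplus_0_r ?Rmult_0_r ?Rplus_0_l ?Rminus_0_r.
    right; repeat f_equal; ring.
  - apply C_ext; unfold Re, Im; simpl; ring.
Qed.

Lemma im_le_Cmod x : Rabs (Im x) <= Cmod x.
Proof. eapply Rle_trans; [apply Rmax_r|apply Rmax_Cmod]. Qed.

Lemma Cmod_Cexp w : Cmod (Cexp w) = exp (Re w).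
Proof.
  assert (H : Cmod (Cexp w) ^ 2 = exp (Re w) ^ 2).
  { rewrite Cmod2_alt. unfold Cexp at 1 2. unfold Re at 1, Im at 2; simpl.
    pose proof (sin2_cos2 (Im w)) as E. unfold Rsqr in E.
    set (s := sin _) in *. set (c := cos _) in *. set (e := exp _).
    replace (e * c * (e * c * 1) + e * s * (e * s * 1)) with (e * e * (s * s + c * c)) by ring.
    rewrite E. ring. }
  pose proof (exp_pos (Re w)). pose proof (Cmod_ge_0 (Cexp w)).
  nra.
Qed.

Lemma Cexp_plus a b : Cexp (a + b)%C = (Cexp a * Cexp b)%C.
Proof.
  destruct a as [a1 a2], b as [b1 b2]. unfold Cexp. unfold Re, Im; simpl.
  rewrite exp_plus cos_plus sin_plus. apply C_ext; unfold Re, Im; simpl; ring.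
Qed.

Lemma exp_bounds_half a : Rabs a <= 1 / 2 -> 0 <= exp a - 1 - a <= 2 * a ^ 2.
Proof.
  intros Ha. apply Rabs_le_between in Ha.
  pose proof (exp_ineq1_le a). pose proof (exp_ineq1_le (- a)) as K.
  pose proof (exp_pos a). split; [lra|].
  assert (E : exp a * exp (- a) = 1) by (rewrite -exp_plus Rplus_opp_r; apply exp_0).
  nra.
Qed.

Lemma Rabs_sin_le b : Rabs (sin b) <= Rabs b.
Proof.
  assert (Hpos : forall u, 0 < u -> Rabs (sin u) <= u).
  { intros u Hu. pose proof (sin_lt_x u Hu).
    apply Rabs_le_between. split; [|lra].
    destruct (Rle_lt_dec u PI).
    - pose proof (sin_ge_0 u ltac:(lra) r). lra.
    - pose proof (SIN_bound u). pose proof PI2_1. lra. }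
  destruct (Rtotal_order b 0) as [H|[->|H]].
  - rewrite -(Rabs_Ropp (sin b)) -sin_neg (Rabs_left b); [|lra]. apply Hpos; lra.
  - rewrite sin_0. lra.
  - rewrite (Rabs_right b); [|lra]. now apply Hpos.
Qed.

Lemma cos_bounds_2 b : 0 <= 1 - cos b <= b ^ 2 / 2.
Proof.
  pose proof (COS_bound b). split; [lra|].
  assert (H1 : 1 - cos b = 2 * sin (b / 2) ^ 2).
  { replace b with (2 * (b / 2)) at 1 by field. rewrite cos_2a_sin. ring. }
  pose proof (Rabs_sin_le (b / 2)) as H2.
  apply Rsqr_le_abs_1 in H2. unfold Rsqr in H2. nra.
Qed.

Lemma sin_bounds_2 b : Rabs b <= 1 -> Rabs (sin b - b) <= b ^ 2.
Proof.
  intros Hb.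
  assert (Hpos : forall u, 0 < u <= 1 -> Rabs (sin u - u) <= u ^ 2).
  { intros u Hu.
    destruct (MVT_open (fun x => sin x - x) (fun x => cos x - 1) 0 u) as [c [E Hc]];
      [lra| |].
    - intros x _. auto_derive; [trivial|ring].
    - rewrite sin_0 in E. pose proof (cos_bounds_2 c).
      apply Rabs_le_between. nra. }
  destruct (Rtotal_order b 0) as [H|[->|H]].
  - rewrite Rabs_left in Hb; [|lra].
    replace (sin b - b) with (- (sin (- b) - - b)) by (rewrite sin_neg; ring).
    rewrite Rabs_Ropp. replace (b ^ 2) with ((- b) ^ 2) by ring. apply Hpos; lra.
  - rewrite sin_0 Rminus_0_r Rabs_R0. lra.
  - rewrite Rabs_right in Hb; [|lra]. apply Hpos; lra.
Qed.

(** Second-order bound for the complex exponential at 0, from bounds of the real functions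
    in each coordinate. *)
Lemma Cexp_bounds h : Cmod h <= 1 / 2 ->
  Cmod (Cexp h - 1 - h)%C <= 5 * Cmod h ^ 2.
Proof.
  intros Hh. pose proof (re_le_Cmod h) as Ha. pose proof (im_le_Cmod h) as Hb.
  eapply Rle_trans; [apply Cmod_le_Rabs|].
  rewrite Cmod2_alt.
  destruct h as [a b]. unfold Cexp, Re, Im in *; simpl in *.
  pose proof (exp_bounds_half a ltac:(lra)) as He.
  pose proof (sin_bounds_2 b ltac:(lra)) as Hs.
  pose proof (cos_bounds_2 b) as Hc.
  assert (Ha' : Rabs a <= 1 / 2) by lra. assert (Hb' : Rabs b <= 1 / 2) by lra.
  apply Rabs_le_between in Ha', Hb', Hs.
  set (e := exp a) in *. set (s := sin b) in *. set (c := cos b) in *.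
  assert (He2 : 0 <= e <= 2) by nra.
  assert (H1 : Rabs (e * c + - (1) + - a) <= 2 * a ^ 2 + b ^ 2).
  { apply Rabs_le_between.
    replace (e * c + - (1) + - a) with ((e - 1 - a) - e * (1 - c)) by ring. nra. }
  assert (H2 : Rabs (e * s + - 0 + - b) <= 3 * b ^ 2 + a ^ 2).
  { replace (e * s + - 0 + - b) with (e * (s - b) + b * (e - 1)) by ring.
    eapply Rle_trans; [apply Rabs_triang|].
    rewrite !Rabs_mult (Rabs_right e); [|lra].
    assert (K1 : Rabs (s - b) <= b ^ 2) by (apply Rabs_le_between; lra).
    assert (K2 : Rabs (e - 1) <= 2 * Rabs a).
    { replace (e - 1) with ((e - 1 - a) + a) by ring.
      eapply Rle_trans; [apply Rabs_triang|].
      rewrite (Rabs_right (e - 1 - a)); [|lra].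
      assert (a ^ 2 = Rabs a * Rabs a) by (rewrite -Rabs_mult Rabs_right; nra).
      pose proof (Rabs_pos a). nra. }
    assert (K3 : Rabs b * Rabs b = b ^ 2) by (rewrite -Rabs_mult Rabs_right; nra).
    assert (K4 : Rabs a * Rabs a = a ^ 2) by (rewrite -Rabs_mult Rabs_right; nra).
    pose proof (Rabs_pos a). pose proof (Rabs_pos b). pose proof (Rabs_pos (s - b)).
    assert (e * Rabs (s - b) <= 2 * b ^ 2) by nra.
    assert (Rabs b * Rabs (e - 1) <= 2 * (Rabs a * Rabs b)) by nra.
    assert (0 <= (Rabs a - Rabs b) ^ 2) by apply pow2_ge_0. nra. }
  simpl in *. nra.
Qed.

(** Since 1 + w <> 0, the denominator vanishes only to first order at w, and the factor
    om - w compensates that zero. *)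
Lemma wlogder_bounded_near w : (1 + w)%C <> 0%C ->
  exists d M, 0 < d /\ 0 < M /\ forall om, om <> w -> Cmod (om - w)%C < d ->
    Cmod (wlogder (w * Cexp w)%C w om) <= M.
Proof.
  intros Hw. set (m := Cmod (1 + w)%C). set (W := Cmod w).
  assert (Hm : 0 < m) by (now apply Cmod_gt_0).
  assert (HW : 0 <= W) by apply Cmod_ge_0.
  (* For |h| < d the second-order terms of the denominator are at most half of the
     first-order term h (1 + w). *)
  set (d := Rmin (1 / 2) (m / (2 * (5 * W + 4)))).
  assert (Hq : 0 < m / (2 * (5 * W + 4))) by (apply Rdiv_lt_0_compat; lra).
  assert (Hd0 : 0 < d) by (apply Rmin_pos; lra).
  exists d, (2 * (m + 1) * 4 / m).
  split; [exact Hd0|]. split; [apply Rdiv_lt_0_compat; lra|].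
  intros om Hom Hd. set (h := (om - w)%C) in *.
  assert (Eom : om = (w + h)%C) by (unfold h; ring).
  assert (Hh : h <> 0%C).
  { intros E. apply Hom. rewrite Eom E. ring. }
  assert (Hh0 : 0 < Cmod h) by now apply Cmod_gt_0.
  assert (Hh1 : Cmod h <= 1 / 2) by (pose proof (Rmin_l (1/2) (m / (2 * (5 * W + 4)))); unfold d in Hd; lra).
  assert (Hh2 : Cmod h * (2 * (5 * W + 4)) <= m).
  { pose proof (Rmin_r (1/2) (m / (2 * (5 * W + 4)))). fold d in H.
    apply Rle_div_r; lra. }
  pose proof (Cexp_bounds h Hh1) as Hb.
  set (r := (Cexp h - 1 - h)%C) in *.
  assert (Eh : Cexp h = (1 + h + r)%C) by (unfold r; ring).
  assert (Eden : den (w * Cexp w)%C om =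
     (Cexp w * (h * (1 + w) + (h * h + (w * r + h * r))))%C).
  { unfold den. rewrite Eom Cexp_plus Eh. ring. }
  assert (Hrest : Cmod (h * h + (w * r + h * r))%C <= Cmod h * (m / 2)).
  { eapply Rle_trans; [apply Cmod_triangle|]. rewrite Cmod_mult.
    pose proof (Cmod_triangle (w * r)%C (h * r)%C) as T. rewrite !Cmod_mult in T. fold W in T.
    pose proof (Cmod_ge_0 r).
    assert (W * Cmod r <= W * (5 * Cmod h ^ 2)) by nra.
    assert (Cmod h * Cmod r <= 1 / 2 * (5 * Cmod h ^ 2)) by nra.
    assert (Cmod h * Cmod h + (W * (5 * Cmod h ^ 2) + 1 / 2 * (5 * Cmod h ^ 2)) <= Cmod h * (m / 2)).
    { replace (Cmod h * Cmod h + (W * (5 * Cmod h ^ 2) + 1 / 2 * (5 * Cmod h ^ 2)))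
        with (Cmod h * (Cmod h * (5 * W + 7 / 2))) by field.
      apply Rmult_le_compat_l; lra || nra. }
    lra. }
  assert (Hden : exp (Re w) * (Cmod h * (m / 2)) <= Cmod (den (w * Cexp w)%C om)).
  { rewrite Eden Cmod_mult Cmod_Cexp.
    apply Rmult_le_compat_l; [left; apply exp_pos|].
    pose proof (Cmod_triangle (h * (1 + w) + (h * h + (w * r + h * r)))%C
       (- (h * h + (w * r + h * r)))%C) as T.
    rewrite Cmod_opp in T.
    replace (h * (1 + w) + (h * h + (w * r + h * r)) + - (h * h + (w * r + h * r)))%C
      with (h * (1 + w))%C in T by ring.
    rewrite Cmod_mult in T. fold m in T. lra. }
  pose proof (exp_pos (Re w)) as He.
  assert (Hpos : 0 < exp (Re w) * (Cmod h * (m / 2))).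
  { apply Rmult_lt_0_compat; [exact He|]. apply Rmult_lt_0_compat; lra. }
  assert (Hdn : den (w * Cexp w)%C om <> 0%C) by (apply Cmod_gt_0; lra).
  unfold wlogder. rewrite Cmod_div; [|exact Hdn].
  apply Rle_div_l; [lra|].
  eapply Rle_trans; [|apply Rmult_le_compat_l; [|exact Hden]].
  2:{ left; apply Rdiv_lt_0_compat; lra. }
  fold h. rewrite !Cmod_mult. rewrite {2}Eom Cexp_plus Cmod_mult Cmod_Cexp.
  assert (H1 : Cmod (1 + om)%C <= m + 1).
  { replace (1 + om)%C with ((1 + w) + h)%C by (rewrite Eom; ring).
    eapply Rle_trans; [apply Cmod_triangle|]. fold m. lra. }
  assert (H2 : Cmod (Cexp h) <= 4).
  { rewrite Eh. eapply Rle_trans; [apply Cmod_triangle|].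
    pose proof (Cmod_triangle 1 h) as T. rewrite Cmod_1 in T.
    pose proof (Cmod_ge_0 h). nra. }
  replace (2 * (m + 1) * 4 / m * (exp (Re w) * (Cmod h * (m / 2))))
    with (Cmod h * (m + 1) * (exp (Re w) * 4)) by (field; lra).
  pose proof (Cmod_ge_0 (1 + om)%C). pose proof (Cmod_ge_0 (Cexp h)).
  apply Rmult_le_compat.
  - apply Rmult_le_pos; lra.
  - apply Rmult_le_pos; lra.
  - apply Rmult_le_compat_l; lra.
  - apply Rmult_le_compat_l; lra.
Qed.

(** * Cauchy's theorem by contraction of the contour *)

Lemma range_W_neq_m1 w : range_W w -> (1 + w)%C <> 0%C.
Proof.
  intros [H1 H2] E. pose proof (ycot_le_1 _ H1) as K.
  destruct w as [x y]. unfold Re, Im in *; simpl in *. injection E as E1 E2.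
  assert (y = 0) by lra. subst y. rewrite ycot_0 in H2. lra.
Qed.

Lemma is_cderive_0_const (f : R -> C) (a b : R) :
  a <= b -> (forall k, a <= k <= b -> is_cderive f k 0) -> f a = f b.
Proof.
  intros [Hab|E] H; [|now rewrite E].
  apply C_ext.
  - destruct (MVT_open (fun k => Re (f k)) (fun _ => 0) a b Hab) as [c [E _]]; [|lra].
    intros x Hx. apply (H x Hx).
  - destruct (MVT_open (fun k => Im (f k)) (fun _ => 0) a b Hab) as [c [E _]]; [|lra].
    intros x Hx. apply (H x Hx).
Qed.

Section Contour.
Variables z w : C.
Hypothesis Hz : ~ on_cut 0 z.
Hypothesis HwD : range_W w.
Hypothesis Hwz : (w * Cexp w)%C = z.

(** Paths in the closure of [range_W] that avoid w; the last clause also covers the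
    boundary, where injectivity is not available. *)
Definition admissible_path (p dp : R -> C) (a b : R) : Prop :=
  a <= b /\
  forall v, a <= v <= b ->
    locally v (fun v' => is_cderive p v' (dp v') /\ ccontinuous dp v') /\
    -PI < Im (p v) < PI /\ - ycot (Im (p v)) <= Re (p v) /\ den z (p v) <> 0%C.

Lemma den_w : den z w = 0%C.
Proof. unfold den. rewrite Hwz. ring. Qed.

Lemma den_range_W om : range_W om -> den z om = 0%C -> om = w.
Proof.
  intros HD E. assert (E' : (om * Cexp om)%C = z).
  { replace z with (om * Cexp om - den z om)%C by (unfold den; ring). rewrite E. ring. }
  apply mulexp_inj; try assumption; now rewrite E'.
Qed.

Lemma shrink_neq_w p dp a b k v : admissible_path p dp a b -> a <= v <= b -> 0 < k ->
  shrink w p k v <> w.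
Proof.
  intros [_ Hp] Hv Hk E. destruct (Hp v Hv) as [_ [_ [_ Hn]]].
  apply Hn. replace (p v) with w; [apply den_w|].
  assert (E' : (RtoC k * (p v - w))%C = 0%C).
  { replace (RtoC k * (p v - w))%C with (shrink w p k v - w)%C by (unfold shrink; ring).
    rewrite E. ring. }
  assert (E0 : (p v - w)%C = 0%C).
  { apply NNPP. intros N. revert E'. apply Cmult_neq_0; [|exact N].
    intros K. injection K as K. lra. }
  replace (p v) with (w + (p v - w))%C by ring. rewrite E0. ring.
Qed.

(** For k < 1 the contracted point lies in the open region by convexity, so that it can be a
    zero of the denominator only by being w itself. *)
Lemma den_shrink p dp a b k v : admissible_path p dp a b -> a <= v <= b -> 0 < k <= 1 ->
  den z (shrink w p k v) <> 0%C.
Proof.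
  intros Ha Hv Hk. destruct (Req_dec k 1) as [->|Hk1].
  - replace (shrink w p 1 v) with (p v) by (unfold shrink; ring).
    now destruct Ha as [_ Hp]; apply Hp.
  - intros E. apply (shrink_neq_w p dp a b k v Ha Hv ltac:(lra)).
    apply den_range_W; [|exact E].
    destruct (proj2 Ha v Hv) as [_ [P1 [P2 _]]].
    apply range_W_convex; try assumption; lra.
Qed.

Lemma admissible_continuous p dp a b : admissible_path p dp a b ->
  forall v, a <= v <= b -> ccontinuous p v /\ ccontinuous dp v.
Proof.
  intros [_ Hp] v Hv. destruct (Hp v Hv) as [Hl _].
  apply locally_singleton in Hl. destruct Hl as [H1 H2].
  split; [exact (is_cderive_continuous _ _ _ H1)|exact H2].
Qed.

(** The length of the contracted arc is O(k), while the integrand stays bounded. *)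
Lemma arc_integral_small p dp a b : admissible_path p dp a b ->
  exists k0 M, 0 < k0 /\ 0 < M /\
    forall k, 0 < k < k0 -> Cmod (arc_integral z w p dp a b k) <= k * M.
Proof.
  intros Ha. pose proof (admissible_continuous _ _ _ _ Ha) as Hc.
  pose proof (proj1 Ha) as Hab.
  destruct (ccontinuous_bounded (fun v => p v - w)%C a b Hab) as [Mp [Hp0 Hp]].
  { intros v Hv. apply ccontinuous_minus; [apply Hc, Hv|apply ccontinuous_const]. }
  destruct (ccontinuous_bounded dp a b Hab) as [Md [Hd0 Hd]].
  { intros v Hv. apply Hc, Hv. }
  destruct (wlogder_bounded_near w (range_W_neq_m1 w HwD)) as [d [M [Hd1 [HM HF]]]].
  rewrite Hwz in HF.
  exists (Rmin 1 (d / Mp)), ((b - a + 1) * (M * Md)).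
  assert (0 < d / Mp) by (apply Rdiv_lt_0_compat; lra).
  split; [apply Rmin_pos; lra|].
  split; [apply Rmult_lt_0_compat; [lra|now apply Rmult_lt_0_compat]|].
  intros k Hk. pose proof (Rmin_l 1 (d / Mp)). pose proof (Rmin_r 1 (d / Mp)).
  assert (Hkd : k * Mp < d).
  { apply Rlt_div_r; lra. }
  eapply Rle_trans.
  - apply (Cmod_CInt_le _ a b (M * (k * Md)) Hab).
    + intros v Hv. apply ccontinuous_mult.
      * apply ccontinuous_wlogder; [|apply (den_shrink p dp a b); lra || assumption].
        apply ccontinuous_plus; [apply ccontinuous_const|].
        apply ccontinuous_mult; [apply ccontinuous_const|].
        apply ccontinuous_minus; [apply Hc, Hv|apply ccontinuous_const].
      * apply ccontinuous_mult; [apply ccontinuous_const|apply Hc, Hv].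
    + intros v Hv. rewrite Cmod_mult (Cmod_mult (RtoC k)) Cmod_R (Rabs_right k); [|lra].
      apply Rmult_le_compat; try apply Cmod_ge_0.
      * apply Rmult_le_pos; [lra|apply Cmod_ge_0].
      * apply HF; [apply (shrink_neq_w p dp a b); lra || assumption|].
        replace (shrink w p k v - w)%C with (RtoC k * (p v - w))%C by (unfold shrink; ring).
        rewrite Cmod_mult Cmod_R (Rabs_right k); [|lra].
        pose proof (Hp v Hv). pose proof (Cmod_ge_0 (p v - w)%C). nra.
      * apply Rmult_le_compat_l; [lra|now apply Hd].
  - assert (0 < M * Md) by (now apply Rmult_lt_0_compat).
    replace ((b - a) * (M * (k * Md))) with (k * ((b - a) * (M * Md))) by ring.
    apply Rmult_le_compat_l; [lra|]. nra.
Qed.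

(** Cauchy's theorem for [wlogder] on a closed contour of four arcs: the integral does not
    change while the contour is contracted towards w, and tends to 0 in the process. *)
Lemma contour_zero p1 d1 a1 b1 p2 d2 a2 b2 p3 d3 a3 b3 p4 d4 a4 b4 :
  admissible_path p1 d1 a1 b1 -> admissible_path p2 d2 a2 b2 ->
  admissible_path p3 d3 a3 b3 -> admissible_path p4 d4 a4 b4 ->
  p3 b3 = p1 b1 -> p3 a3 = p2 b2 -> p4 b4 = p1 a1 -> p4 a4 = p2 a2 ->
  (CInt (fun v => wlogder z w (p1 v) * d1 v)%C a1 b1 - CInt (fun v => wlogder z w (p2 v) * d2 v)%C a2 b2
   - CInt (fun v => wlogder z w (p3 v) * d3 v)%C a3 b3 + CInt (fun v => wlogder z w (p4 v) * d4 v)%C a4 b4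
   = 0)%C.
Proof.
  intros H1 H2 H3 H4 E31 E32 E41 E42.
  set (J := fun k => (arc_integral z w p1 d1 a1 b1 k - arc_integral z w p2 d2 a2 b2 k
    - arc_integral z w p3 d3 a3 b3 k + arc_integral z w p4 d4 a4 b4 k)%C).
  assert (Hone : forall p dp a b, arc_integral z w p dp a b 1 = CInt (fun v => wlogder z w (p v) * dp v)%C a b).
  { intros p dp a b. unfold arc_integral, CInt. f_equal; apply RInt_ext; intros v _.
    - replace (shrink w p 1 v) with (p v) by (unfold shrink; ring).
      replace (RtoC 1 * dp v)%C with (dp v) by ring. reflexivity.
    - replace (shrink w p 1 v) with (p v) by (unfold shrink; ring).
      replace (RtoC 1 * dp v)%C with (dp v) by ring. reflexivity. }
  rewrite -!Hone. change (J 1 = 0%C).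
  assert (HJ : forall k, 0 < k <= 1 -> is_cderive J k 0).
  { intros k Hk.
    assert (Hpc : forall p dp a b, admissible_path p dp a b ->
      is_cderive (arc_integral z w p dp a b) k
       (wlogder z w (shrink w p k b) * (p b - w) - wlogder z w (shrink w p k a) * (p a - w))%C).
    { intros p dp a b Hp. apply is_cderive_arc_integral; [apply Hp| |].
      - intros v Hv. apply (proj2 Hp v Hv).
      - intros v Hv. now apply (den_shrink p dp a b). }
    pose proof (Hpc _ _ _ _ H1) as K1. pose proof (Hpc _ _ _ _ H2) as K2.
    pose proof (Hpc _ _ _ _ H3) as K3. pose proof (Hpc _ _ _ _ H4) as K4.
    pose proof (is_cderive_plus _ _ _ _ _
      (is_cderive_minus _ _ _ _ _ (is_cderive_minus _ _ _ _ _ K1 K2) K3) K4) as K.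
    assert (Eh : forall p a q b, p a = q b -> shrink w p k a = shrink w q k b).
    { intros p a q b E. unfold shrink. now rewrite E. }
    rewrite (Eh _ _ _ _ E31) (Eh _ _ _ _ E32) (Eh _ _ _ _ E41) (Eh _ _ _ _ E42)
      E31 E32 E41 E42 in K.
    match type of K with is_cderive _ _ ?l => replace (RtoC 0) with l by ring end.
    exact K. }
  destruct (arc_integral_small _ _ _ _ H1) as [k1 [M1 [Hk1 [HM1 B1]]]].
  destruct (arc_integral_small _ _ _ _ H2) as [k2 [M2 [Hk2 [HM2 B2]]]].
  destruct (arc_integral_small _ _ _ _ H3) as [k3 [M3 [Hk3 [HM3 B3]]]].
  destruct (arc_integral_small _ _ _ _ H4) as [k4 [M4 [Hk4 [HM4 B4]]]].
  apply Cmod_eq_0. apply Rle_antisym; [|apply Cmod_ge_0].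
  apply Rle_plus_epsilon. intros eps Heps. rewrite Rplus_0_l.
  set (M := M1 + M2 + M3 + M4).
  assert (0 < eps / M) by (apply Rdiv_lt_0_compat; unfold M; lra).
  set (k := Rmin 1 (Rmin (eps / M) (Rmin (Rmin k1 k2) (Rmin k3 k4))) / 2).
  assert (Hk : 0 < k /\ k <= 1 /\ k < eps / M /\ k < k1 /\ k < k2 /\ k < k3 /\ k < k4).
  { assert (0 < Rmin 1 (Rmin (eps / M) (Rmin (Rmin k1 k2) (Rmin k3 k4))))
      by (repeat apply Rmin_pos; lra).
    pose proof (Rmin_l 1 (Rmin (eps / M) (Rmin (Rmin k1 k2) (Rmin k3 k4)))).
    pose proof (Rmin_r 1 (Rmin (eps / M) (Rmin (Rmin k1 k2) (Rmin k3 k4)))).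
    pose proof (Rmin_l (eps / M) (Rmin (Rmin k1 k2) (Rmin k3 k4))).
    pose proof (Rmin_r (eps / M) (Rmin (Rmin k1 k2) (Rmin k3 k4))).
    pose proof (Rmin_l (Rmin k1 k2) (Rmin k3 k4)). pose proof (Rmin_r (Rmin k1 k2) (Rmin k3 k4)).
    pose proof (Rmin_l k1 k2). pose proof (Rmin_r k1 k2).
    pose proof (Rmin_l k3 k4). pose proof (Rmin_r k3 k4). unfold k. lra. }
  rewrite -(is_cderive_0_const J k 1); [|lra|intros; apply HJ; lra].
  unfold J.
  pose proof (B1 k ltac:(lra)). pose proof (B2 k ltac:(lra)).
  pose proof (B3 k ltac:(lra)). pose proof (B4 k ltac:(lra)).
  assert (k * M < eps).
  { apply Rlt_div_r; [unfold M; lra|]. lra. }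
  eapply Rle_trans; [apply Cmod_triangle|].
  eapply Rle_trans; [apply Rplus_le_compat_r, Cmod_triangle|].
  eapply Rle_trans; [apply Rplus_le_compat_r, Rplus_le_compat_r, Cmod_triangle|].
  rewrite !Cmod_opp. unfold M in *. lra.
Qed.

End Contour.

(** * The contour integral along the boundary *)

Lemma CInt_ext f g a b : a <= b -> (forall v, a < v < b -> f v = g v) ->
  CInt f a b = CInt g a b.
Proof.
  intros Hab H. unfold CInt.
  f_equal; apply RInt_ext; rewrite Rmin_left; try lra; rewrite Rmax_right; try lra;
  intros v Hv; now rewrite H.
Qed.

Lemma ex_RInt_Re f a b : a <= b -> (forall v, a <= v <= b -> ccontinuous f v) ->
  ex_RInt (fun v => Re (f v)) a b.
Proof.
  intros Hab H. apply: ex_RInt_continuous. rewrite Rmin_left; [|lra].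
  rewrite Rmax_right; [|lra]. intros v Hv. apply (H v Hv).
Qed.

Lemma ex_RInt_Im f a b : a <= b -> (forall v, a <= v <= b -> ccontinuous f v) ->
  ex_RInt (fun v => Im (f v)) a b.
Proof.
  intros Hab H. apply: ex_RInt_continuous. rewrite Rmin_left; [|lra].
  rewrite Rmax_right; [|lra]. intros v Hv. apply (H v Hv).
Qed.

Lemma CInt_minus f g a b : a <= b ->
  (forall v, a <= v <= b -> ccontinuous f v) ->
  (forall v, a <= v <= b -> ccontinuous g v) ->
  CInt (fun v => f v - g v)%C a b = (CInt f a b - CInt g a b)%C.
Proof.
  intros Hab Hf Hg. apply C_ext.
  - exact (RInt_minus _ _ a b (ex_RInt_Re f a b Hab Hf) (ex_RInt_Re g a b Hab Hg)).
  - exact (RInt_minus _ _ a b (ex_RInt_Im f a b Hab Hf) (ex_RInt_Im g a b Hab Hg)).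
Qed.

Lemma CInt_plus f g a b : a <= b ->
  (forall v, a <= v <= b -> ccontinuous f v) ->
  (forall v, a <= v <= b -> ccontinuous g v) ->
  CInt (fun v => f v + g v)%C a b = (CInt f a b + CInt g a b)%C.
Proof.
  intros Hab Hf Hg. apply C_ext.
  - exact (RInt_plus _ _ a b (ex_RInt_Re f a b Hab Hf) (ex_RInt_Re g a b Hab Hg)).
  - exact (RInt_plus _ _ a b (ex_RInt_Im f a b Hab Hf) (ex_RInt_Im g a b Hab Hg)).
Qed.

Lemma CInt_const c a b : CInt (fun _ => c) a b = (RtoC (b - a) * c)%C.
Proof.
  unfold CInt. rewrite !RInt_const. unfold scal; simpl; unfold mult; simpl.
  apply C_ext; unfold Re, Im; simpl; ring.
Qed.

Lemma CInt_scal c f a b : a <= b ->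
  (forall v, a <= v <= b -> ccontinuous f v) ->
  CInt (fun v => c * f v)%C a b = (c * CInt f a b)%C.
Proof.
  intros Hab Hf.
  pose proof (ex_RInt_Re f a b Hab Hf) as H1. pose proof (ex_RInt_Im f a b Hab Hf) as H2.
  apply C_ext.
  - transitivity (RInt (fun v => minus (scal (Re c) (Re (f v))) (scal (Im c) (Im (f v)))) a b);
      [reflexivity|].
    rewrite RInt_minus; [|now apply: ex_RInt_scal|now apply: ex_RInt_scal].
    rewrite !RInt_scal; [reflexivity|assumption|assumption].
  - transitivity (RInt (fun v => plus (scal (Re c) (Im (f v))) (scal (Im c) (Re (f v)))) a b);
      [reflexivity|].
    rewrite RInt_plus; [|now apply: ex_RInt_scal|now apply: ex_RInt_scal].
    rewrite !RInt_scal; [reflexivity|assumption|assumption].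
Qed.

Lemma z_neq_real z r : ~ on_cut 0 z -> r <= 0 -> (RtoC r - z)%C <> 0%C.
Proof.
  intros Hz Hr E. apply Hz.
  replace z with (RtoC r); [split; [reflexivity|exact Hr]|].
  replace z with (RtoC r - (RtoC r - z))%C by ring. rewrite E. ring.
Qed.

(** The vertical chord of [range_W] through the points [bdry c] and its conjugate. *)
Definition vline (c y : R) : C := (- ycot c, y).

Definition vline_integral (z w : C) (c : R) : C :=
  CInt (fun y => wlogder z w (vline c y) * Ci)%C (- c) c.

(** The factor v t'(v) / (t(v) - z) left by the two conjugate boundary curves. *)
Definition bdry_density (z : C) (v : R) : C :=
  (RtoC (v * dt v) / (RtoC (t v) - z))%C.

Lemma continuous_t v : 0 < v < PI -> continuous t v.
Proof.
  intros Hv. pose proof (sin_gt_0 v ltac:(lra) ltac:(lra)).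
  apply: ex_derive_continuous. unfold t, csc, cot. auto_derive. repeat split; lra.
Qed.

Lemma continuous_dt v : 0 < v < PI -> continuous dt v.
Proof.
  intros Hv. pose proof (sin_gt_0 v ltac:(lra) ltac:(lra)).
  apply: ex_derive_continuous. unfold dt, t, csc, cot. auto_derive. repeat split; lra.
Qed.

Lemma ccontinuous_bdry_density z v : ~ on_cut 0 z -> 0 < v < PI -> ccontinuous (bdry_density z) v.
Proof.
  intros Hz Hv. apply ccontinuous_div.
  - apply ccontinuous_RtoC. apply: continuous_mult; [apply continuous_id|now apply continuous_dt].
  - apply ccontinuous_minus; [|apply ccontinuous_const].
    apply ccontinuous_RtoC. now apply continuous_t.
  - apply z_neq_real; [exact Hz|]. pose proof (t_neg v Hv). lra.
Qed.

Lemma locally_open_interval a b v (P : R -> Prop) :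
  a < v < b -> (forall u, a < u < b -> P u) -> locally v P.
Proof.
  intros Hv H. exists (mkposreal (Rmin (v - a) (b - v)) ltac:(apply Rmin_pos; lra)).
  intros u Hu. change (Rabs (u - v) < Rmin (v - a) (b - v)) in Hu.
  pose proof (Rmin_l (v - a) (b - v)). pose proof (Rmin_r (v - a) (b - v)).
  apply Rabs_lt_between in Hu. apply H. lra.
Qed.

Lemma den_bdry z v : ~ on_cut 0 z -> 0 < v < PI -> den z (bdry v) = (RtoC (t v) - z)%C.
Proof. intros Hz Hv. unfold den. now rewrite bdry_mulexp. Qed.

Lemma den_bdry_conj z v : ~ on_cut 0 z -> 0 < v < PI ->
  den z (Cconj (bdry v)) = (RtoC (t v) - z)%C.
Proof.
  intros Hz Hv. unfold den. rewrite mulexp_conj bdry_mulexp; [|exact Hv].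
  f_equal. apply C_ext; unfold Re, Im; simpl; ring.
Qed.

Section Curve.
Variables (z w : C) (a b : R).
Hypothesis Hz : ~ on_cut 0 z.
Hypothesis HwD : range_W w.
Hypothesis Hwz : (w * Cexp w)%C = z.
Hypothesis Hab : 0 < a < b /\ b < PI.
Hypothesis Hwab : - ycot a < Re w < - ycot b.

Lemma admissible_bdry : admissible_path z bdry dbdry a b.
Proof.
  split; [lra|]. intros v Hv. assert (Hv' : 0 < v < PI) by lra.
  split; [|split; [|split]].
  - apply (locally_open_interval 0 PI); [exact Hv'|].
    intros u Hu. split; [now apply is_cderive_bdry|now apply ccontinuous_dbdry].
  - unfold bdry, Im; simpl; lra.
  - unfold bdry, Re, Im; simpl; lra.
  - rewrite den_bdry; try assumption. apply z_neq_real; [exact Hz|].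
    pose proof (t_neg v Hv'). lra.
Qed.

Lemma admissible_bdry_conj :
  admissible_path z (fun v => Cconj (bdry v)) (fun v => Cconj (dbdry v)) a b.
Proof.
  split; [lra|]. intros v Hv. assert (Hv' : 0 < v < PI) by lra.
  split; [|split; [|split]].
  - apply (locally_open_interval 0 PI); [exact Hv'|].
    intros u Hu. destruct (is_cderive_bdry u Hu) as [G1 G2].
    destruct (ccontinuous_dbdry u Hu) as [C1 C2].
    split; split.
    + exact G1.
    + exact (is_derive_opp _ _ _ G2).
    + exact C1.
    + exact (continuous_opp _ _ C2).
  - unfold bdry, Im; simpl; lra.
  - unfold bdry, Re, Im; simpl. rewrite ycot_opp; lra.
  - rewrite den_bdry_conj; try assumption. apply z_neq_real; [exact Hz|].
    pose proof (t_neg v Hv'). lra.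
Qed.

Lemma admissible_vline c : 0 < c < PI -> Re w <> - ycot c ->
  admissible_path z (vline c) (fun _ => Ci) (- c) c.
Proof.
  intros Hc Hne. split; [lra|]. intros v Hv.
  assert (Hin : - c < v < c -> range_W (vline c v)).
  { intros Hv'. unfold range_W, Re, Im; simpl. split; [lra|].
    rewrite -(ycot_abs v).
    assert (Rabs v < c) by (apply Rabs_def1; lra).
    pose proof (ycot_decr (Rabs v) c (Rabs_pos v) H ltac:(lra)). lra. }
  split; [|split; [|split]].
  - apply filter_forall. intros u. split; [|apply ccontinuous_const].
    split; unfold Re, Im; simpl; [apply: is_derive_const|apply: is_derive_id].
  - unfold Im; simpl; lra.
  - destruct (Req_dec v c) as [->|H1]; [unfold Re, Im; simpl; lra|].
    destruct (Req_dec v (- c)) as [->|H2]; [unfold Re, Im; simpl; rewrite ycot_opp; lra|].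
    pose proof (Hin ltac:(lra)) as [_ K]. lra.
  - destruct (Req_dec v c) as [->|H1].
    { change (vline c c) with (bdry c). rewrite den_bdry; try assumption.
      apply z_neq_real; [exact Hz|]. pose proof (t_neg c Hc). lra. }
    destruct (Req_dec v (- c)) as [->|H2].
    { change (vline c (- c)) with (Cconj (bdry c)). rewrite den_bdry_conj; try assumption.
      apply z_neq_real; [exact Hz|]. pose proof (t_neg c Hc). lra. }
    intros E. apply Hne. pose proof (Hin ltac:(lra)) as K.
    rewrite -(den_range_W z w Hz HwD Hwz _ K E). reflexivity.
Qed.

Lemma wlogder_bdry v : 0 < v < PI ->
  (wlogder z w (bdry v) * dbdry v)%C = ((bdry v - w) * RtoC (dt v) / (RtoC (t v) - z))%C.
Proof.
  intros Hv. unfold wlogder. rewrite den_bdry; try assumption.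
  rewrite -bdry_dt; [|exact Hv]. field.
  apply z_neq_real; [exact Hz|]. pose proof (t_neg v Hv). lra.
Qed.

Lemma wlogder_bdry_conj v : 0 < v < PI ->
  (wlogder z w (Cconj (bdry v)) * Cconj (dbdry v))%C
   = ((Cconj (bdry v) - w) * RtoC (dt v) / (RtoC (t v) - z))%C.
Proof.
  intros Hv. unfold wlogder. rewrite den_bdry_conj; try assumption.
  assert (E : ((1 + Cconj (bdry v)) * Cexp (Cconj (bdry v)) * Cconj (dbdry v))%C = RtoC (dt v)).
  { replace (RtoC (dt v)) with (Cconj (RtoC (dt v))) by (apply C_ext; unfold Re, Im; simpl; ring).
    rewrite -bdry_dt; [|exact Hv].
    generalize (bdry v) (dbdry v). intros [x y] [x' y'].
    apply C_ext; unfold Re, Im; simpl; rewrite cos_neg sin_neg; ring. }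
  rewrite -E. field.
  apply z_neq_real; [exact Hz|]. pose proof (t_neg v Hv). lra.
Qed.

(** The conjugate curves contribute (om - w) t' / (t - z) and the same with the conjugate of
    om; the difference is 2 i times [bdry_density]. *)
Lemma bdry_integral_eq :
  (2 * Ci * CInt (bdry_density z) a b)%C = (vline_integral z w b - vline_integral z w a)%C.
Proof.
  pose proof (contour_zero z w Hz HwD Hwz _ _ _ _ _ _ _ _ _ _ _ _ _ _ _ _
    admissible_bdry admissible_bdry_conj
    (admissible_vline b ltac:(lra) ltac:(lra)) (admissible_vline a ltac:(lra) ltac:(lra))
    eq_refl eq_refl eq_refl eq_refl) as H.
  cbv beta in H.
  fold (vline_integral z w b) (vline_integral z w a) in H.
  rewrite (CInt_ext _ (fun v => (bdry v - w) * RtoC (dt v) / (RtoC (t v) - z))%C) in H;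
    [|lra|intros v Hv; apply wlogder_bdry; lra].
  rewrite (CInt_ext (fun v => wlogder z w (Cconj (bdry v)) * Cconj (dbdry v))%C
    (fun v => (Cconj (bdry v) - w) * RtoC (dt v) / (RtoC (t v) - z))%C) in H;
    [|lra|intros v Hv; apply wlogder_bdry_conj; lra].
  assert (Hc : forall q : R -> C, (forall v, 0 < v < PI -> ccontinuous q v) ->
    forall v, a <= v <= b -> ccontinuous (fun v => (q v - w) * RtoC (dt v) / (RtoC (t v) - z))%C v).
  { intros q Hq v Hv. apply ccontinuous_div.
    - apply ccontinuous_mult.
      + apply ccontinuous_minus; [apply Hq; lra|apply ccontinuous_const].
      + apply ccontinuous_RtoC, continuous_dt. lra.
    - apply ccontinuous_minus; [|apply ccontinuous_const].
      apply ccontinuous_RtoC, continuous_t. lra.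
    - apply z_neq_real; [exact Hz|]. pose proof (t_neg v ltac:(lra)). lra. }
  rewrite -CInt_minus in H; [|lra| |].
  - rewrite (CInt_ext _ (fun v => (2 * Ci) * bdry_density z v)%C) in H; [|lra|].
    + rewrite CInt_scal in H; [|lra|intros v Hv; apply ccontinuous_bdry_density; [exact Hz|lra]].
      set (I := (2 * Ci * CInt (bdry_density z) a b)%C) in *.
      replace I with (I - vline_integral z w b + vline_integral z w a + (vline_integral z w b - vline_integral z w a))%C by ring.
      rewrite H. ring.
    + intros v Hv. unfold bdry_density.
      replace (RtoC (v * dt v)) with (RtoC v * RtoC (dt v))%C by (apply C_ext; unfold Re, Im; simpl; ring).
      replace (bdry v) with (RtoC (- ycot v) + Ci * RtoC v)%C
        by (apply C_ext; unfold bdry, Re, Im; simpl; ring).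
      replace (Cconj (RtoC (- ycot v) + Ci * RtoC v)) with (RtoC (- ycot v) - Ci * RtoC v)%C
        by (apply C_ext; unfold Re, Im; simpl; ring).
      field. apply z_neq_real; [exact Hz|]. pose proof (t_neg v ltac:(lra)). lra.
  - apply Hc. intros v Hv. eapply is_cderive_continuous, is_cderive_bdry, Hv.
  - apply Hc. intros v Hv.
    destruct (is_cderive_continuous _ _ _ (is_cderive_bdry v Hv)) as [C1 C2].
    split; [exact C1|exact (continuous_opp _ _ C2)].
Qed.

End Curve.

(** * The two chords in the limit *)

(** With u = pi - b, - b cot b = b cos u / sin u >= 1 / u for small u. *)
Lemma ycot_at_PI X : exists d, 0 < d /\ forall b, PI - d < b < PI -> X < - ycot b.
Proof.
  exists (Rmin 1 (/ (Rabs X + 1))).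
  assert (H0 : 0 < / (Rabs X + 1)) by (apply Rinv_0_lt_compat; pose proof (Rabs_pos X); lra).
  split; [apply Rmin_pos; lra|]. intros b Hb.
  pose proof (Rmin_l 1 (/ (Rabs X + 1))). pose proof (Rmin_r 1 (/ (Rabs X + 1))).
  pose proof PI2_3_2. rewrite ycot_neq; [|lra].
  set (u := PI - b). assert (Hu : 0 < u < 1 /\ u < / (Rabs X + 1)) by (unfold u; lra).
  replace b with (PI - u) by (unfold u; lra).
  rewrite sin_PI_x. replace (cos (PI - u)) with (- cos u)
    by (rewrite cos_minus cos_PI sin_PI; ring).
  pose proof (sin_lt_x u ltac:(lra)). pose proof (sin_gt_0 u ltac:(lra) ltac:(lra)) as Hs.
  pose proof (cos_bounds_2 u).
  replace (- ((PI - u) * - cos u / sin u)) with ((PI - u) * cos u / sin u) by (field; lra).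
  apply Rlt_div_r; [lra|].
  assert (Hc : 1 / 2 < cos u) by nra.
  assert (HX : (Rabs X + 1) * u < 1).
  { destruct Hu as [_ Hu]. apply (Rmult_lt_compat_l (Rabs X + 1)) in Hu; [|pose proof (Rabs_pos X); lra].
    rewrite Rinv_r in Hu; [|pose proof (Rabs_pos X); lra]. exact Hu. }
  pose proof (Rle_abs X). pose proof (Rabs_pos X). nra.
Qed.

(** Concavity gives a lower bound for ycot on [0, 1] that is linear with value 1 at 0. *)
Lemma ycot_at_0 eps : 0 < eps -> exists d, 0 < d /\ d <= 1 /\ forall a, 0 < a < d -> 1 - eps < ycot a < 1.
Proof.
  intros Heps. pose proof PI2_3_2.
  pose proof (ycot_lt_1 1 ltac:(lra)) as H1. set (c := 1 - ycot 1).
  assert (0 < c) by (unfold c; lra).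
  exists (Rmin 1 (eps / c)).
  assert (0 < eps / c) by (apply Rdiv_lt_0_compat; lra).
  pose proof (Rmin_l 1 (eps / c)). pose proof (Rmin_r 1 (eps / c)).
  split; [apply Rmin_pos; lra|]. split; [lra|]. intros a Ha.
  pose proof (ycot_concave a 0 1 ltac:(lra) ltac:(lra) ltac:(lra)) as K.
  replace (0 + a * (1 - 0)) with a in K by ring. rewrite ycot_0 in K.
  split; [|apply ycot_lt_1; lra].
  assert (a * c < eps) by (apply Rlt_div_r; lra). unfold c in *. nra.
Qed.

Lemma ccontinuous_vline c y : ccontinuous (vline c) y.
Proof. split; unfold vline, Re, Im; simpl; [apply continuous_const|apply continuous_id]. Qed.

(** The difference is exactly (z (om + 1 - w) - w exp om) / (om exp om - z), in which exp om
    dominates. *)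
Lemma wlogder_far z w : exists X M, 0 < X /\ 0 < M /\ forall om,
  X <= Re om -> Rabs (Im om) <= PI ->
  den z om <> 0%C /\ Cmod (wlogder z w om - (om + 1 - w))%C <= M / Re om.
Proof.
  set (Z := Cmod z). set (W := Cmod w).
  assert (HZ : 0 <= Z) by apply Cmod_ge_0. assert (HW : 0 <= W) by apply Cmod_ge_0.
  exists (2 * Z + 1), (2 * (W + Z * (6 + W)) + 1).
  assert (0 <= Z * W) by nra.
  split; [lra|]. split; [nra|]. intros om Hx Hy.
  set (x := Re om) in *. set (e := exp x).
  pose proof (exp_ineq1_le x) as He. fold e in He.
  assert (Hmx : x <= Cmod om).
  { pose proof (re_le_Cmod om) as K. pose proof (Rle_abs x). fold x in K. lra. }
  assert (HmX : Cmod om <= x + PI).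
  { eapply Rle_trans; [apply Cmod_le_Rabs|]. fold x. rewrite (Rabs_right x); lra. }
  assert (Hd : x * e / 2 <= Cmod (den z om)).
  { pose proof (Cmod_triangle (den z om) z) as T.
    replace (den z om + z)%C with (om * Cexp om)%C in T by (unfold den; ring).
    rewrite Cmod_mult Cmod_Cexp in T. fold x e Z in T.
    assert (x * e <= Cmod om * e) by (apply Rmult_le_compat_r; lra).
    assert (2 * Z <= x * e) by nra. lra. }
  assert (Hpos : 0 < x * e / 2) by nra.
  assert (Hn : den z om <> 0%C) by (apply Cmod_gt_0; lra).
  split; [exact Hn|].
  replace (wlogder z w om - (om + 1 - w))%C
    with ((z * (om + 1 - w) - w * Cexp om) / den z om)%C.
  2:{ unfold wlogder. unfold den in *. field. exact Hn. }
  rewrite Cmod_div; [|exact Hn].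
  apply Rle_div_l; [lra|].
  eapply Rle_trans; [|apply Rmult_le_compat_l; [|exact Hd]].
  2:{ apply Rmult_le_pos; [nra|left; apply Rinv_0_lt_compat; lra]. }
  replace ((2 * (W + Z * (6 + W)) + 1) / x * (x * e / 2))
    with (((W + Z * (6 + W)) + 1 / 2) * e) by (field; lra).
  eapply Rle_trans; [apply Cmod_triangle|].
  rewrite Cmod_opp !Cmod_mult Cmod_Cexp. fold x e Z W.
  assert (Cmod (om + 1 - w)%C <= x + PI + 1 + W).
  { eapply Rle_trans; [apply Cmod_triangle|]. rewrite Cmod_opp.
    pose proof (Cmod_triangle om 1) as T. rewrite Cmod_1 in T. fold W. lra. }
  pose proof PI_4.
  assert (Cmod (om + 1 - w)%C <= (6 + W) * e) by nra.
  assert (Z * Cmod (om + 1 - w)%C <= Z * ((6 + W) * e)) by (apply Rmult_le_compat_l; lra).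
  nra.
Qed.

Lemma vline_integral_far z w : exists X M, 0 < X /\ 0 < M /\ forall b, 0 < b < PI ->
  X <= - ycot b ->
  Cmod (vline_integral z w b - CInt (fun y => (vline b y + 1 - w) * Ci)%C (- b) b)%C
    <= 2 * PI * (M / (- ycot b)).
Proof.
  destruct (wlogder_far z w) as [X [M [HX [HM HF]]]].
  exists X, M. split; [exact HX|]. split; [exact HM|]. intros b Hb Hbx.
  assert (HF' : forall y, - b <= y <= b -> den z (vline b y) <> 0%C /\
     Cmod (wlogder z w (vline b y) - (vline b y + 1 - w))%C <= M / (- ycot b)).
  { intros y Hy. apply HF; [exact Hbx|]. apply Rabs_le_between. unfold vline, Im; simpl. lra. }
  assert (C0 : forall y, - b <= y <= b -> ccontinuous (fun y => wlogder z w (vline b y) * Ci)%C y).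
  { intros y Hy. apply ccontinuous_mult; [|apply ccontinuous_const].
    apply ccontinuous_wlogder; [apply ccontinuous_vline|now apply HF']. }
  assert (C1 : forall y, - b <= y <= b -> ccontinuous (fun y => (vline b y + 1 - w) * Ci)%C y).
  { intros y Hy. apply ccontinuous_mult; [|apply ccontinuous_const].
    apply ccontinuous_minus; [|apply ccontinuous_const].
    apply ccontinuous_plus; [apply ccontinuous_vline|apply ccontinuous_const]. }
  unfold vline_integral. rewrite -CInt_minus; [|lra|exact C0|exact C1].
  eapply Rle_trans; [apply (Cmod_CInt_le _ (- b) b (M / (- ycot b))); [lra| |]|].
  - intros y Hy. apply ccontinuous_minus; [now apply C0|now apply C1].
  - intros y Hy.
    replace (wlogder z w (vline b y) * Ci - (vline b y + 1 - w) * Ci)%C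
      with ((wlogder z w (vline b y) - (vline b y + 1 - w)) * Ci)%C by ring.
    rewrite Cmod_mult Cmod_Ci Rmult_1_r. now apply HF'.
  - apply Rmult_le_compat_r; [|lra].
    left. apply Rdiv_lt_0_compat; lra.
Qed.

(** Near -1, the limit of the left chord, the integrand is bounded because z is not the
    value -1/e of om exp om there. *)
Lemma vline_integral_near z w : ~ on_cut 0 z -> exists d M, 0 < d /\ 0 < M /\
  forall a, 0 < a < d -> Cmod (vline_integral z w a) <= 2 * a * M.
Proof.
  intros Hz.
  assert (Hid : forall p : R * R, ccontinuous (fun om : R * R => (om : C)) p).
  { intros p. split; [apply: continuous_fst|apply: continuous_snd]. }
  (* -1 is the limit of the chords; there om exp om = -1/e. *)
  assert (Hd1 : den z (-1, 0) <> 0%C).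
  { unfold den. rewrite (mulexp_Im_0 (-1, 0) eq_refl).
    apply z_neq_real; [exact Hz|]. unfold Re; simpl. pose proof (exp_pos (-1)). lra. }
  pose proof (ccontinuous_wlogder z w _ _ (Hid (-1, 0)) Hd1) as HF.
  pose proof (ccontinuous_den z _ _ (Hid (-1, 0))) as Hd.
  assert (L1 : locally_2d (fun x y => den z (x, y) <> 0%C) (-1) 0).
  { apply (ccontinuous2_neq_0 (fun x y => den z (x, y))); [|exact Hd1].
    unfold ccontinuous2.
    apply (ccontinuous_ext (fun om : R * R => den z om)); [|exact Hd].
    intros [x y]; reflexivity. }
  set (M := Rabs (Re (wlogder z w (-1, 0))) + Rabs (Im (wlogder z w (-1, 0))) + 2).
  assert (HF2 : ccontinuous2 (fun x y => wlogder z w (x, y)) (-1) 0).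
  { apply (ccontinuous_ext (fun om : R * R => wlogder z w om)); [|exact HF].
    intros [x y]; reflexivity. }
  pose proof (ccontinuous2_Re _ _ _ HF2 (mkposreal 1 Rlt_0_1)) as [d1 D1].
  pose proof (ccontinuous2_Im _ _ _ HF2 (mkposreal 1 Rlt_0_1)) as [d2 D2].
  destruct L1 as [d3 D3]. change (pos (mkposreal 1 Rlt_0_1)) with 1 in D1, D2.
  set (d := Rmin d1 (Rmin d2 d3)).
  assert (Hdpos : 0 < d).
  { apply Rmin_pos; [apply cond_pos|apply Rmin_pos; apply cond_pos]. }
  destruct (ycot_at_0 d Hdpos) as [d' [Hd' [Hd'1 Hy]]].
  exists (Rmin d d'), M.
  split; [apply Rmin_pos; lra|].
  split; [unfold M; pose proof (Rabs_pos (Re (wlogder z w (-1, 0)))); pose proof (Rabs_pos (Im (wlogder z w (-1, 0)))); lra|].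
  intros a Ha.
  pose proof (Rmin_l d d'). pose proof (Rmin_r d d').
  assert (E : d <= d1 /\ d <= d2 /\ d <= d3).
  { pose proof (Rmin_l d1 (Rmin d2 d3)). pose proof (Rmin_r d1 (Rmin d2 d3)).
    pose proof (Rmin_l d2 d3). pose proof (Rmin_r d2 d3). unfold d. lra. }
  destruct (Hy a ltac:(lra)) as [Y1 Y2].
  assert (B1 : Rabs (- ycot a - -1) < d) by (apply Rabs_def1; lra).
  assert (B2 : forall y, - a <= y <= a -> Rabs (y - 0) < d) by (intros y Hya; apply Rabs_def1; lra).
  replace (2 * a * M) with ((a - - a) * M) by ring.
  apply Cmod_CInt_le; [lra| |].
  - intros y Hya. pose proof (B2 y Hya). apply ccontinuous_mult; [|apply ccontinuous_const].
    apply ccontinuous_wlogder; [apply ccontinuous_vline|]. apply D3; lra.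
  - intros y Hya. pose proof (B2 y Hya).
    rewrite Cmod_mult Cmod_Ci Rmult_1_r.
    eapply Rle_trans; [apply Cmod_le_Rabs|].
    pose proof (D1 (- ycot a) y ltac:(lra) ltac:(lra)) as K1.
    pose proof (D2 (- ycot a) y ltac:(lra) ltac:(lra)) as K2.
    change (wlogder z w (- ycot a, y)) with (wlogder z w (vline a y)) in K1, K2.
    pose proof (Rabs_triang_inv (Re (wlogder z w (vline a y))) (Re (wlogder z w (-1, 0)))).
    pose proof (Rabs_triang_inv (Im (wlogder z w (vline a y))) (Im (wlogder z w (-1, 0)))).
    unfold M. lra.
Qed.

(** Each right chord integral diverges, like the integral of om + 1 - w; only the difference
    of two of them has a limit. *)
Lemma bdry_integral_limit z w z0 w0 :
  ~ on_cut 0 z -> range_W w -> (w * Cexp w)%C = z ->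
  ~ on_cut 0 z0 -> range_W w0 -> (w0 * Cexp w0)%C = z0 ->
  forall eps, 0 < eps -> exists d, 0 < d /\ d <= 1 /\ forall a b,
    0 < a < d -> PI - d < b < PI ->
    Cmod (CInt (bdry_density z) a b - CInt (bdry_density z0) a b - RtoC PI * (w0 - w))%C <= eps.
Proof.
  intros Hz HD Hw Hz0 HD0 Hw0 eps Heps.
  pose proof PI2_3_2 as HPI.
  destruct (vline_integral_far z w) as [X [M [HX [HM Hf]]]].
  destruct (vline_integral_far z0 w0) as [X0 [M0 [HX0 [HM0 Hf0]]]].
  destruct (vline_integral_near z w Hz) as [d1 [N [Hd1 [HN Hn]]]].
  destruct (vline_integral_near z0 w0 Hz0) as [d2 [N0 [Hd2 [HN0 Hn0]]]].
  (* L makes the two chord errors together at most eps/2, and puts w, w0 and the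
     thresholds of the chord estimates to its left. *)
  set (L := Rmax (Rmax X X0) (Rmax (Rmax (Re w) (Re w0)) (2 * PI * (M + M0) / (eps / 2)))).
  destruct (ycot_at_PI L) as [d3 [Hd3 Hy3]].
  assert (Hre : forall u, range_W u -> -1 < Re u).
  { intros u [H1 H2]. pose proof (ycot_le_1 _ H1). lra. }
  pose proof (Hre w HD) as Hr. pose proof (Hre w0 HD0) as Hr0.
  destruct (ycot_at_0 (Rmin (1 + Re w) (1 + Re w0)) ltac:(apply Rmin_pos; lra)) as [d4 [Hd4 [Hd41 Hy4]]].
  set (Q := Cmod (w0 - w)%C). assert (HQ : 0 <= Q) by apply Cmod_ge_0.
  (* d * S bounds the left chords and the defect pi - b in the limit value. *)
  set (S := 2 * Q + 2 * (N + N0) + 1).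
  assert (HS : 0 < S) by (unfold S; lra).
  set (d := Rmin (Rmin 1 (eps / S)) (Rmin (Rmin d1 d2) (Rmin d3 d4))).
  assert (HeS : 0 < eps / S) by (apply Rdiv_lt_0_compat; lra).
  assert (Hd : 0 < d /\ d <= 1 /\ d <= eps / S /\ d <= d1 /\ d <= d2 /\ d <= d3 /\ d <= d4).
  { assert (0 < d) by (repeat apply Rmin_pos; lra).
    pose proof (Rmin_l (Rmin 1 (eps / S)) (Rmin (Rmin d1 d2) (Rmin d3 d4))).
    pose proof (Rmin_r (Rmin 1 (eps / S)) (Rmin (Rmin d1 d2) (Rmin d3 d4))).
    pose proof (Rmin_l 1 (eps / S)). pose proof (Rmin_r 1 (eps / S)).
    pose proof (Rmin_l (Rmin d1 d2) (Rmin d3 d4)). pose proof (Rmin_r (Rmin d1 d2) (Rmin d3 d4)).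
    pose proof (Rmin_l d1 d2). pose proof (Rmin_r d1 d2).
    pose proof (Rmin_l d3 d4). pose proof (Rmin_r d3 d4). fold d in H0, H1. lra. }
  exists d. split; [lra|]. split; [lra|]. intros a b Ha Hb.
  pose proof (Hy3 b ltac:(lra)) as HL.
  assert (HL' : X <= L /\ X0 <= L /\ Re w <= L /\ Re w0 <= L /\ 2 * PI * (M + M0) / (eps / 2) <= L).
  { pose proof (Rmax_l (Rmax X X0) (Rmax (Rmax (Re w) (Re w0)) (2 * PI * (M + M0) / (eps / 2)))).
    pose proof (Rmax_r (Rmax X X0) (Rmax (Rmax (Re w) (Re w0)) (2 * PI * (M + M0) / (eps / 2)))).
    pose proof (Rmax_l X X0). pose proof (Rmax_r X X0).
    pose proof (Rmax_l (Rmax (Re w) (Re w0)) (2 * PI * (M + M0) / (eps / 2))).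
    pose proof (Rmax_r (Rmax (Re w) (Re w0)) (2 * PI * (M + M0) / (eps / 2))).
    pose proof (Rmax_l (Re w) (Re w0)). pose proof (Rmax_r (Re w) (Re w0)). fold L in H, H0. lra. }
  destruct (Hy4 a ltac:(lra)) as [Ya _].
  pose proof (Rmin_l (1 + Re w) (1 + Re w0)). pose proof (Rmin_r (1 + Re w) (1 + Re w0)).
  pose proof (bdry_integral_eq z w a b Hz HD Hw ltac:(lra) ltac:(lra)) as E.
  pose proof (bdry_integral_eq z0 w0 a b Hz0 HD0 Hw0 ltac:(lra) ltac:(lra)) as E0.
  pose proof (Hf b ltac:(lra) ltac:(lra)) as K1. pose proof (Hf0 b ltac:(lra) ltac:(lra)) as K2.
  pose proof (Hn a ltac:(lra)) as K3. pose proof (Hn0 a ltac:(lra)) as K4.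
  set (G := CInt (fun y => (vline b y + 1 - w) * Ci)%C (- b) b) in *.
  set (G0 := CInt (fun y => (vline b y + 1 - w0) * Ci)%C (- b) b) in *.
  assert (EG : (G - G0)%C = (RtoC (2 * b) * ((w0 - w) * Ci))%C).
  { assert (Cc : forall u y, ccontinuous (fun y => (vline b y + 1 - u) * Ci)%C y).
    { intros u y. apply ccontinuous_mult; [|apply ccontinuous_const].
      apply ccontinuous_minus; [|apply ccontinuous_const].
      apply ccontinuous_plus; [apply ccontinuous_vline|apply ccontinuous_const]. }
    unfold G, G0. rewrite -CInt_minus; [|lra|auto|auto].
    rewrite (CInt_ext _ (fun _ => (w0 - w) * Ci)%C); [|lra|intros v _; ring].
    rewrite CInt_const. f_equal. f_equal. ring. }
  set (U := (CInt (bdry_density z) a b - CInt (bdry_density z0) a b - RtoC PI * (w0 - w))%C).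
  assert (EU : (2 * Ci * U)%C =
     ((vline_integral z w b - G) + - (vline_integral z0 w0 b - G0) + (- vline_integral z w a + (vline_integral z0 w0 a
       + RtoC (2 * (b - PI)) * ((w0 - w) * Ci))))%C).
  { replace (2 * Ci * U)%C with ((2 * Ci * CInt (bdry_density z) a b)
       - (2 * Ci * CInt (bdry_density z0) a b) - RtoC 2 * RtoC PI * ((w0 - w) * Ci))%C
      by (unfold U; ring).
    rewrite E E0.
    transitivity (vline_integral z w b - vline_integral z w a - (vline_integral z0 w0 b - vline_integral z0 w0 a)
      - (G - G0) + (RtoC (2 * b) * ((w0 - w) * Ci)) - RtoC 2 * RtoC PI * ((w0 - w) * Ci))%C.
    - rewrite EG. ring.
    - replace (RtoC (2 * (b - PI))) with (RtoC (2 * b) - RtoC 2 * RtoC PI)%C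
        by (apply C_ext; unfold Re, Im; simpl; ring). ring. }
  assert (HU : 2 * Cmod U = Cmod (2 * Ci * U)%C).
  { rewrite !Cmod_mult Cmod_Ci Cmod_R Rabs_right; lra. }
  assert (T : Cmod (2 * Ci * U)%C <= (2 * PI * (M / (- ycot b)) + 2 * PI * (M0 / (- ycot b)))
    + (2 * a * N + (2 * a * N0 + 2 * d * Q))).
  { rewrite EU. eapply Rle_trans; [apply Cmod_triangle|]. apply Rplus_le_compat.
    - eapply Rle_trans; [apply Cmod_triangle|]. rewrite Cmod_opp. lra.
    - eapply Rle_trans; [apply Cmod_triangle|]. rewrite Cmod_opp. apply Rplus_le_compat; [lra|].
      eapply Rle_trans; [apply Cmod_triangle|]. apply Rplus_le_compat; [lra|].
      rewrite Cmod_mult Cmod_R Cmod_mult Cmod_Ci Rmult_1_r. fold Q.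
      apply Rmult_le_compat_r; [exact HQ|]. apply Rabs_le_between. lra. }
  assert (T1 : 2 * PI * (M / (- ycot b)) + 2 * PI * (M0 / (- ycot b)) <= eps / 2).
  { replace (2 * PI * (M / (- ycot b)) + 2 * PI * (M0 / (- ycot b)))
      with (2 * PI * (M + M0) / (- ycot b)) by (field; lra).
    apply Rle_div_l; [lra|]. rewrite (Rmult_comm (eps / 2)). apply Rle_div_l; lra. }
  assert (T2 : d * S <= eps) by (apply Rle_div_r; lra).
  assert (T3 : 2 * a * N + (2 * a * N0 + 2 * d * Q) <= d * S).
  { unfold S. nra. }
  lra.
Qed.

(** * The integral of the theorem *)

Lemma CInt_Chasles f a b c : a <= b -> b <= c ->
  (forall v, a <= v <= c -> ccontinuous f v) ->
  CInt f a c = (CInt f a b + CInt f b c)%C.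
Proof.
  intros Hab Hbc H.
  assert (H1 : forall v, a <= v <= b -> ccontinuous f v) by (intros; apply H; lra).
  assert (H2 : forall v, b <= v <= c -> ccontinuous f v) by (intros; apply H; lra).
  apply C_ext; symmetry.
  - exact (RInt_Chasles _ _ _ _ (ex_RInt_Re f a b Hab H1) (ex_RInt_Re f b c Hbc H2)).
  - exact (RInt_Chasles _ _ _ _ (ex_RInt_Im f a b Hab H1) (ex_RInt_Im f b c Hbc H2)).
Qed.

Lemma ccontinuous_ext_loc {T : UniformSpace} (f g : T -> C) x :
  locally x (fun u => f u = g u) -> ccontinuous f x -> ccontinuous g x.
Proof.
  intros H [H1 H2]; split; [apply: continuous_ext_loc H1|apply: continuous_ext_loc H2];
  revert H; apply filter_imp; intros u Hu; simpl; now rewrite Hu.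
Qed.

Lemma ccontinuous_zero (f : R -> C) (x : R) : f x = 0%C ->
  (forall eps, 0 < eps -> exists d, 0 < d /\ forall u, Rabs (u - x) < d -> Cmod (f u) <= eps) ->
  ccontinuous f x.
Proof.
  intros Hx H. split; apply continuity_pt_filterlim; intros eps Heps;
  destruct (H (eps / 2)) as [d [Hd Hf]]; try lra;
  exists d; split; try exact Hd; intros u [_ Hu]; rewrite Hx;
  change (Rabs (u - x) < d) in Hu; specialize (Hf u Hu).
  - change (Rabs (Re (f u) - 0) < eps). rewrite Rminus_0_r.
    pose proof (re_le_Cmod (f u)). lra.
  - change (Rabs (Im (f u) - 0) < eps). rewrite Rminus_0_r.
    pose proof (im_le_Cmod (f u)). lra.
Qed.

(** The distance from z to a point s of (-oo, 0] is bounded below, and at least |s| - |z|;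
    both are captured by one linear bound. *)
Lemma dist_lower z : ~ on_cut 0 z ->
  exists d, 0 < d /\ forall s, s <= 0 -> d * (1 + Rabs s) <= Cmod (z - RtoC s)%C.
Proof.
  intros Hz. set (Z := Cmod z). assert (HZ : 0 <= Z) by apply Cmod_ge_0.
  assert (He : exists e, 0 < e /\ forall s, s <= 0 -> e <= Cmod (z - RtoC s)%C).
  { destruct z as [x y]. destruct (Req_dec y 0) as [->|Hy].
    - exists x. assert (0 < x).
      { apply Rnot_le_lt. intros K. apply Hz. split; [reflexivity|exact K]. }
      split; [assumption|]. intros s Hs.
      eapply Rle_trans; [|apply re_le_Cmod]. unfold Re; simpl.
      eapply Rle_trans; [|apply Rle_abs]. lra.
    - exists (Rabs y). split; [now apply Rabs_pos_lt|]. intros s Hs.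
      eapply Rle_trans; [|apply im_le_Cmod]. unfold Im; simpl. right. f_equal. lra. }
  destruct He as [e [He Hs]].
  set (q := e / (2 * Z + 2)).
  assert (Hq : 0 < q) by (apply Rdiv_lt_0_compat; lra).
  exists (Rmin (1 / 4) q). split; [apply Rmin_pos; lra|]. intros s Hs0.
  pose proof (Rmin_l (1 / 4) q). pose proof (Rmin_r (1 / 4) q).
  assert (0 < Rmin (1 / 4) q) by (apply Rmin_pos; lra).
  pose proof (Rabs_pos s).
  destruct (Rle_lt_dec (2 * Z + 1) (Rabs s)) as [H'|H'].
  - pose proof (Cmod_triangle (z - RtoC s)%C (- z)%C) as T.
    replace (z - RtoC s + - z)%C with (- RtoC s)%C in T by ring.
    rewrite !Cmod_opp Cmod_R in T. fold Z in T.
    set (m := Rmin (1 / 4) q) in *. nra.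
  - eapply Rle_trans; [|apply (Hs s Hs0)].
    assert (E : q * (2 * Z + 2) = e) by (unfold q; field; lra).
    set (m := Rmin (1 / 4) q) in *. nra.
Qed.

Definition integrand (z : C) (v : R) : C := (K z v * RtoC (t v))%C.

Definition weight (v : R) : R := v ^ 2 + (1 - v * cot v) ^ 2.

Lemma weight_ycot v : 0 < v < PI -> weight v = v ^ 2 + (1 - ycot v) ^ 2.
Proof.
  intros Hv. pose proof (sin_gt_0 v ltac:(lra) ltac:(lra)).
  unfold weight, cot. rewrite ycot_neq; [|lra]. do 3 f_equal. field. lra.
Qed.

(** The factor multiplying M is independent of z and tends to 0 at both ends of (0, pi):
    at 0 because of [weight], at pi because of [t]. *)
Lemma Cmod_integrand z : ~ on_cut 0 z -> exists M, 0 < M /\ forall v, 0 < v < PI ->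
  Cmod (integrand z v) <= M * (weight v * (Rabs (t v) / (1 + t v ^ 2))).
Proof.
  intros Hz. destruct (dist_lower z Hz) as [d [Hd Hs]].
  set (Z := Cmod z). assert (HZ : 0 <= Z) by apply Cmod_ge_0.
  exists ((1 + Z) / d). split; [apply Rdiv_lt_0_compat; lra|]. intros v Hv.
  pose proof (t_neg v Hv) as Ht. pose proof (Hs (t v) ltac:(lra)) as K1.
  pose proof (Rabs_pos (t v)).
  assert (Hw : 0 <= weight v).
  { unfold weight. pose proof (pow2_ge_0 v). pose proof (pow2_ge_0 (1 - v * cot v)). lra. }
  assert (Hp : 0 < Cmod (z - RtoC (t v))%C) by nra.
  assert (Hn : (z - RtoC (t v))%C <> 0%C) by now apply Cmod_gt_0.
  assert (Ht2 : 0 < 1 + t v ^ 2) by (pose proof (pow2_ge_0 (t v)); lra).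
  assert (Hn2 : RtoC (1 + t v ^ 2) <> 0%C) by (intros E; injection E as E; lra).
  unfold integrand, K. fold (weight v).
  rewrite Cmod_mult Cmod_div; [|now apply Cmult_neq_0].
  rewrite !Cmod_mult !Cmod_R (Rabs_right (weight v)) ?(Rabs_right (1 + t v ^ 2)); try lra.
  assert (K2 : Cmod (1 + z * RtoC (t v))%C <= (1 + Z) * (1 + Rabs (t v))).
  { eapply Rle_trans; [apply Cmod_triangle|]. rewrite Cmod_1 Cmod_mult Cmod_R. fold Z. nra. }
  set (T := Rabs (t v)) in *. set (S := 1 + t v ^ 2) in *. set (A := Cmod (1 + _)%C) in *.
  set (B := Cmod (z - _)%C) in *. set (P := weight v) in *.
  assert (K3 : A / B <= (1 + Z) / d).
  { apply Rle_div_l; [lra|]. replace ((1 + Z) / d * B) with ((1 + Z) * (B / d)) by (field; lra).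
    assert (1 + T <= B / d) by (apply Rle_div_r; lra). nra. }
  replace (A * P / (B * S) * T) with (A / B * (P * (T / S))) by (field; lra).
  apply Rmult_le_compat_r; [|exact K3].
  apply Rmult_le_pos; [lra|]. apply Rmult_le_pos; [lra|]. left; now apply Rinv_0_lt_compat.
Qed.

(** With X = - v cot v, weight is O(X^2) and |t| >= exp X >= ((1 + X)/4)^4; the constant is
    17 * 4^4. *)
Lemma weight_t_bound_PI v : 2 < v < PI -> 1 < - ycot v ->
  weight v * (Rabs (t v) / (1 + t v ^ 2)) <= 4352 / (- ycot v).
Proof.
  intros Hv HX. pose proof (sin_gt_0 v ltac:(lra) ltac:(lra)) as Hs.
  pose proof (sin_lt_x v ltac:(lra)) as Hsx. pose proof PI_4.
  set (X := - ycot v) in *.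
  assert (Hw : weight v <= 17 * (1 + X) ^ 2).
  { rewrite weight_ycot; [|lra]. replace (1 - ycot v) with (1 + X) by (unfold X; ring). nra. }
  assert (Hw0 : 0 <= weight v).
  { unfold weight. pose proof (pow2_ge_0 v). pose proof (pow2_ge_0 (1 - v * cot v)). lra. }
  assert (Ht : exp X <= Rabs (t v)).
  { rewrite Rabs_left; [|apply t_neg; lra].
    unfold t, csc, cot. unfold X. rewrite ycot_neq; [|lra].
    replace (- v * (cos v / sin v)) with (- (v * cos v / sin v)) by (field; lra).
    set (e := exp _). assert (0 < e) by apply exp_pos.
    replace (- (- v * / sin v * e)) with (v / sin v * e) by (field; lra).
    assert (1 <= v / sin v) by (apply Rle_div_r; lra). nra. }
  assert (He : ((1 + X) / 4) ^ 4 <= exp X).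
  { replace X with (X / 4 + X / 4 + (X / 4 + X / 4)) at 2 by field.
    rewrite !exp_plus. pose proof (exp_ineq1_le (X / 4)).
    set (f := exp (X / 4)) in *. 
    assert ((1 + X) / 4 * ((1 + X) / 4) <= f * f) by nra.
    replace (((1 + X) / 4) ^ 4) with (((1 + X) / 4 * ((1 + X) / 4)) * ((1 + X) / 4 * ((1 + X) / 4))) by ring.
    apply Rmult_le_compat; nra. }
  set (T := Rabs (t v)) in *.
  assert (HT2 : t v ^ 2 = T ^ 2) by (unfold T; now rewrite pow2_abs).
  rewrite HT2.
  assert (Hp4 : 0 < ((1 + X) / 4) ^ 4) by (apply pow_lt; lra).
  assert (HT : 0 < T) by lra.
  assert (K1 : T / (1 + T ^ 2) <= / T).
  { apply Rle_div_l; [nra|]. replace (/ T * (1 + T ^ 2)) with (/ T + T) by (field; lra).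
    pose proof (Rinv_0_lt_compat T HT). lra. }
  assert (K2 : / T <= / ((1 + X) / 4) ^ 4) by (apply Rinv_le_contravar; lra).
  apply Rle_trans with (17 * (1 + X) ^ 2 * / ((1 + X) / 4) ^ 4).
  - apply Rmult_le_compat; try lra.
    apply Rmult_le_pos; [lra|]. left; apply Rinv_0_lt_compat; nra.
  - replace (17 * (1 + X) ^ 2 * / ((1 + X) / 4) ^ 4) with (4352 / (1 + X) ^ 2) by (field; lra).
    apply Rmult_le_compat_l; [lra|]. apply Rinv_le_contravar; nra.
Qed.

(** The continuous extension of the integrand by 0 to the ends of [0, pi], where the
    defining formulas divide by zero. *)
Definition ext_integrand (z : C) (v : R) : C :=
  match Rlt_dec 0 v, Rlt_dec v PI with left _, left _ => integrand z v | _, _ => 0%C end.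

Lemma ext_integrand_in z v : 0 < v < PI -> ext_integrand z v = integrand z v.
Proof.
  intros Hv. unfold ext_integrand.
  destruct (Rlt_dec 0 v); [|lra]. destruct (Rlt_dec v PI); [reflexivity|lra].
Qed.

Lemma ext_integrand_out z v : ~ (0 < v < PI) -> ext_integrand z v = 0%C.
Proof.
  intros Hv. unfold ext_integrand.
  destruct (Rlt_dec 0 v); [|reflexivity]. destruct (Rlt_dec v PI); [lra|reflexivity].
Qed.

Lemma ccontinuous_integrand z v : ~ on_cut 0 z -> 0 < v < PI -> ccontinuous (integrand z) v.
Proof.
  intros Hz Hv. pose proof (sin_gt_0 v ltac:(lra) ltac:(lra)).
  pose proof (t_neg v Hv) as Ht.
  assert (Ct : ccontinuous (fun v => RtoC (t v)) v) by now apply ccontinuous_RtoC, continuous_t.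
  unfold integrand, K. apply ccontinuous_mult; [|exact Ct].
  apply ccontinuous_div.
  - apply ccontinuous_mult.
    + apply ccontinuous_plus; [apply ccontinuous_const|].
      apply ccontinuous_mult; [apply ccontinuous_const|exact Ct].
    + apply ccontinuous_RtoC. apply: ex_derive_continuous. unfold cot. auto_derive. lra.
  - apply ccontinuous_mult.
    + apply ccontinuous_minus; [apply ccontinuous_const|exact Ct].
    + apply ccontinuous_RtoC. apply: ex_derive_continuous. unfold t, csc, cot. auto_derive.
      repeat split; lra.
  - apply Cmult_neq_0.
    + intros E. apply (z_neq_real z (t v) Hz ltac:(lra)).
      replace (RtoC (t v) - z)%C with (- (z - RtoC (t v)))%C by ring. rewrite E. ring.
    + intros E. injection E as E. pose proof (pow2_ge_0 (t v)). simpl in *. lra.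
Qed.

Lemma ccontinuous_ext_integrand z v : ~ on_cut 0 z -> 0 <= v <= PI ->
  ccontinuous (ext_integrand z) v.
Proof.
  intros Hz Hv. pose proof PI2_3_2 as HPI.
  destruct (Cmod_integrand z Hz) as [M [HM HI]].
  destruct (Req_dec v 0) as [->|H0]; [|destruct (Req_dec v PI) as [->|H1]].
  - apply ccontinuous_zero; [apply ext_integrand_out; lra|]. intros eps Heps.
    set (e := Rmin 1 (eps / (2 * M))).
    assert (Hq : 0 < eps / (2 * M)) by (apply Rdiv_lt_0_compat; lra).
    pose proof (Rmin_l 1 (eps / (2 * M))). pose proof (Rmin_r 1 (eps / (2 * M))). fold e in H, H0.
    assert (He : 0 < e) by (apply Rmin_pos; lra).
    destruct (ycot_at_0 e He) as [d [Hd [Hd1 Hy]]].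
    exists (Rmin d e). split; [apply Rmin_pos; lra|]. intros u Hu.
    pose proof (Rmin_l d e). pose proof (Rmin_r d e).
    rewrite Rminus_0_r in Hu. apply Rabs_lt_between in Hu.
    destruct (Rle_lt_dec u 0) as [Hu0|Hu0].
    { rewrite ext_integrand_out; [rewrite Cmod_0; lra|lra]. }
    rewrite ext_integrand_in; [|lra]. eapply Rle_trans; [apply HI; lra|].
    destruct (Hy u ltac:(lra)) as [Y1 Y2].
    assert (Hw : weight u <= 2 * e).
    { rewrite weight_ycot; [|lra]. nra. }
    assert (Hw0 : 0 <= weight u) by (rewrite weight_ycot; [|lra]; nra).
    assert (HT : 0 <= Rabs (t u) / (1 + t u ^ 2) <= 1).
    { pose proof (Rabs_pos (t u)) as K. rewrite -(pow2_abs (t u)).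
      set (T := Rabs (t u)) in *. split.
      - apply Rmult_le_pos; [lra|]. left. apply Rinv_0_lt_compat. nra.
      - apply Rle_div_l; nra. }
    assert (weight u * (Rabs (t u) / (1 + t u ^ 2)) <= 2 * e) by nra.
    assert (M * (2 * e) <= eps).
    { assert (e * (2 * M) <= eps) by (apply Rle_div_r; lra). lra. }
    nra.
  - apply ccontinuous_zero; [apply ext_integrand_out; lra|]. intros eps Heps.
    destruct (ycot_at_PI (Rmax 1 (4352 * M / eps))) as [d [Hd Hy]].
    pose proof (Rmax_l 1 (4352 * M / eps)). pose proof (Rmax_r 1 (4352 * M / eps)).
    exists (Rmin d 1). split; [apply Rmin_pos; lra|]. intros u Hu.
    pose proof (Rmin_l d 1). pose proof (Rmin_r d 1).
    apply Rabs_lt_between in Hu.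
    destruct (Rle_lt_dec PI u) as [Hu0|Hu0].
    { rewrite ext_integrand_out; [rewrite Cmod_0; lra|lra]. }
    rewrite ext_integrand_in; [|lra]. eapply Rle_trans; [apply HI; lra|].
    pose proof (Hy u ltac:(lra)) as Y.
    pose proof (weight_t_bound_PI u ltac:(lra) ltac:(lra)) as B.
    apply Rle_trans with (M * (4352 / - ycot u)); [apply Rmult_le_compat_l; lra|].
    replace (M * (4352 / - ycot u)) with (4352 * M / - ycot u) by (field; lra).
    apply Rle_div_l; [lra|]. rewrite (Rmult_comm eps). apply Rle_div_l; lra.
  - apply (ccontinuous_ext_loc (integrand z)).
    + apply (locally_open_interval 0 PI); [lra|]. intros u Hu.
      symmetry. now apply ext_integrand_in.
    + apply ccontinuous_integrand; [exact Hz|lra].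
Qed.

Lemma integrand_diff z z0 v : ~ on_cut 0 z -> ~ on_cut 0 z0 -> 0 < v < PI ->
  (integrand z v - integrand z0 v)%C = (bdry_density z0 v - bdry_density z v)%C.
Proof.
  intros Hz Hz0 Hv. pose proof (t_neg v Hv) as Ht.
  pose proof (z_neq_real z (t v) Hz ltac:(lra)) as N.
  pose proof (z_neq_real z0 (t v) Hz0 ltac:(lra)) as N0.
  assert (Ht2 : 0 < 1 + t v ^ 2) by (pose proof (pow2_ge_0 (t v)); lra).
  assert (Hn2 : RtoC (1 + t v ^ 2) <> 0%C) by (intros E; injection E as E; lra).
  unfold integrand, K, bdry_density. fold (weight v).
  assert (E : v * dt v = t v * weight v) by (unfold dt, weight; field; lra).
  rewrite E.
  replace (RtoC (t v * weight v)) with (RtoC (t v) * RtoC (weight v))%C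
    by (apply C_ext; unfold Re, Im; simpl; ring).
  replace (RtoC (1 + t v ^ 2)) with (1 + RtoC (t v) * RtoC (t v))%C in *
    by (apply C_ext; unfold Re, Im; simpl; ring).
  assert (N' : (z - RtoC (t v))%C <> 0%C).
  { intros E'. apply N. replace (RtoC (t v) - z)%C with (- (z - RtoC (t v)))%C by ring. rewrite E'. ring. }
  assert (N0' : (z0 - RtoC (t v))%C <> 0%C).
  { intros E'. apply N0. replace (RtoC (t v) - z0)%C with (- (z0 - RtoC (t v)))%C by ring. rewrite E'. ring. }
  field. repeat split; assumption.
Qed.

(** Passage to the limit a -> 0, b -> pi; the integrals over the two end pieces are small
    because the extended integrand is bounded. *)
Lemma integral_diff z w z0 w0 :
  ~ on_cut 0 z -> range_W w -> (w * Cexp w)%C = z ->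
  ~ on_cut 0 z0 -> range_W w0 -> (w0 * Cexp w0)%C = z0 ->
  (CInt (ext_integrand z) 0 PI - CInt (ext_integrand z0) 0 PI)%C = (RtoC PI * (w - w0))%C.
Proof.
  intros Hz HD Hw Hz0 HD0 Hw0. pose proof PI2_3_2 as HPI.
  set (h := fun v => (ext_integrand z v - ext_integrand z0 v)%C).
  assert (Ch : forall v, 0 <= v <= PI -> ccontinuous h v).
  { intros v Hv. apply ccontinuous_minus; now apply ccontinuous_ext_integrand. }
  rewrite -CInt_minus; [|lra|intros; now apply ccontinuous_ext_integrand
    |intros; now apply ccontinuous_ext_integrand].
  fold h.
  destruct (ccontinuous_bounded h 0 PI ltac:(lra) Ch) as [M [HM Hb]].
  set (U := (CInt h 0 PI - RtoC PI * (w - w0))%C).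
  assert (HU : U = 0%C).
  { apply Cmod_eq_0. apply Rle_antisym; [|apply Cmod_ge_0].
    apply Rle_plus_epsilon. intros eps Heps. rewrite Rplus_0_l.
    destruct (bdry_integral_limit z w z0 w0 Hz HD Hw Hz0 HD0 Hw0 (eps / 2) ltac:(lra))
      as [d [Hd [Hd1 Hl]]].
    assert (Hq : 0 < eps / (4 * M)) by (apply Rdiv_lt_0_compat; lra).
    (* Two end pieces of length a, on which the integrand is at most M. *)
    set (a := Rmin d (eps / (4 * M)) / 2).
    pose proof (Rmin_l d (eps / (4 * M))). pose proof (Rmin_r d (eps / (4 * M))).
    assert (0 < Rmin d (eps / (4 * M))) by (apply Rmin_pos; lra).
    assert (Ha : 0 < a < d) by (unfold a; lra).
    assert (HaM : a * (4 * M) <= eps) by (apply Rle_div_r; unfold a; lra).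
    specialize (Hl a (PI - a) Ha ltac:(lra)).
    assert (Emid : CInt h a (PI - a) = (CInt (bdry_density z0) a (PI - a) - CInt (bdry_density z) a (PI - a))%C).
    { rewrite -CInt_minus; [|lra|intros; apply ccontinuous_bdry_density; [assumption|lra]
        |intros; apply ccontinuous_bdry_density; [assumption|lra]].
      apply CInt_ext; [lra|]. intros v Hv. unfold h.
      rewrite !ext_integrand_in; [|lra|lra]. apply integrand_diff; try assumption; lra. }
    assert (E : U = (CInt h 0 a + (CInt h (PI - a) PI
       + - (CInt (bdry_density z) a (PI - a) - CInt (bdry_density z0) a (PI - a) - RtoC PI * (w0 - w))))%C).
    { unfold U. rewrite (CInt_Chasles h 0 a PI); [|lra|lra|exact Ch].
      rewrite (CInt_Chasles h a (PI - a) PI); [|lra|lra|intros; apply Ch; lra].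
      rewrite Emid. ring. }
    rewrite E.
    assert (B1 : Cmod (CInt h 0 a) <= (a - 0) * M).
    { apply Cmod_CInt_le; [lra|intros; apply Ch; lra|intros; apply Hb; lra]. }
    assert (B2 : Cmod (CInt h (PI - a) PI) <= (PI - (PI - a)) * M).
    { apply Cmod_CInt_le; [lra|intros; apply Ch; lra|intros; apply Hb; lra]. }
    eapply Rle_trans; [apply Cmod_triangle|].
    eapply Rle_trans; [apply Rplus_le_compat_l, Cmod_triangle|].
    rewrite Cmod_opp. nra. }
  replace (CInt h 0 PI) with (U + RtoC PI * (w - w0))%C by (unfold U; ring).
  rewrite HU. ring.
Qed.

(** * Values of W *)

Lemma IVT_open (f : R -> R) (a b c : R) :
  a < b -> (forall s, a <= s <= b -> continuous f s) -> f a < c < f b ->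
  exists s, a < s < b /\ f s = c.
Proof.
  intros Hab Hc Hf.
  destruct (Ranalysis5.IVT_interv (fun s => f s - c) a b) as [s [Hs E]]; [|lra|lra|lra|].
  - intros s Hs. apply continuity_pt_minus; [apply continuity_pt_filterlim; now apply Hc|].
    apply continuity_pt_const. now intros ? ?.
  - exists s. split; [|lra].
    destruct Hs as [[H1|H1] [H2|H2]]; subst; lra.
Qed.

(** Near 0, om exp om is so close to om that the signs of the imaginary parts agree. *)
Lemma small_range_W om : Rabs (Re om) < 1 / 4 -> Rabs (Im om) < 1 / 4 ->
  0 < Im (om * Cexp om)%C -> 0 < Im om /\ range_W om.
Proof.
  destruct om as [x y]. unfold Re, Im at 1; simpl fst; simpl snd.
  intros Hx Hy HI.
  assert (HI' : 0 < exp x * (x * sin y + y * cos y)).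
  { unfold Im in HI; simpl in HI. lra. }
  pose proof (exp_pos x).
  assert (HI2 : 0 < x * sin y + y * cos y) by nra.
  apply Rabs_lt_between in Hx. pose proof PI2_3_2.
  pose proof (cos_bounds_2 y) as Hc.
  assert (Hc' : 1 / 2 < cos y).
  { apply Rabs_lt_between in Hy. nra. }
  assert (Hpos : 0 < y).
  { apply Rnot_le_lt. intros Hy0.
    pose proof (Rabs_sin_le y) as Hs. rewrite (Rabs_left1 y) in Hs; [|lra].
    apply Rabs_le_between in Hs. nra. }
  apply Rabs_lt_between in Hy.
  split; [exact Hpos|]. split; [unfold Im; simpl; lra|]. unfold Re, Im; simpl.
  rewrite ycot_neq; [|lra].
  pose proof (sin_lt_x y Hpos). pose proof (sin_gt_0 y Hpos ltac:(lra)).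
  assert (0 < y * (cos y - 1 / 2)) by (apply Rmult_lt_0_compat; lra).
  assert (1 / 2 < y * cos y / sin y) by (apply (proj1 (Rlt_div_r (1 / 2) (y * cos y) (sin y) ltac:(lra))); lra). lra.
Qed.

Section Path.
Variables (z : C) (om : R -> C).
Hypothesis H0 : om 0 = 0%C.
Hypothesis Hc : forall s, 0 <= s <= 1 -> ccontinuous om s.
Hypothesis He : forall s, 0 <= s <= 1 -> (om s * Cexp (om s))%C = (RtoC s * z)%C.

Lemma path_Im s : 0 <= s <= 1 -> Im (om s * Cexp (om s))%C = s * Im z.
Proof. intros Hs. rewrite (He s Hs). destruct z; unfold Im; simpl; ring. Qed.

Lemma path_Re s : 0 <= s <= 1 -> Re (om s * Cexp (om s))%C = s * Re z.
Proof. intros Hs. rewrite (He s Hs). destruct z; unfold Re; simpl; ring. Qed.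

(** Along the path, Im (om exp om) > 0.  Hence Im om cannot vanish, and the argument of
    om exp om cannot reach pi; both have the right value near s = 0. *)
Lemma path_range_W_up : 0 < Im z -> range_W (om 1).
Proof.
  intros Hz.
  assert (Hs0 : exists s0, 0 < s0 < 1 /\ 0 < Im (om s0) /\ range_W (om s0)).
  { destruct (Hc 0 ltac:(lra)) as [C1 C2].
    apply continuity_pt_filterlim in C1, C2.
    destruct (C1 (1 / 4) ltac:(lra)) as [d1 [Hd1 D1]].
    destruct (C2 (1 / 4) ltac:(lra)) as [d2 [Hd2 D2]].
    set (s0 := Rmin (1 / 2) (Rmin d1 d2 / 2)).
    pose proof (Rmin_l d1 d2). pose proof (Rmin_r d1 d2).
    assert (0 < Rmin d1 d2) by (apply Rmin_pos; lra).
    pose proof (Rmin_l (1 / 2) (Rmin d1 d2 / 2)) as L1. pose proof (Rmin_r (1 / 2) (Rmin d1 d2 / 2)) as L2.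
    assert (0 < s0) by (apply Rmin_pos; lra). fold s0 in L1, L2.
    exists s0. split; [lra|].
    assert (Hd : Rabs (s0 - 0) < d1 /\ Rabs (s0 - 0) < d2).
    { rewrite Rminus_0_r Rabs_right; lra. }
    specialize (D1 s0). specialize (D2 s0). rewrite H0 in D1, D2.
    unfold dist in D1, D2; simpl in D1, D2. unfold Rdist in D1, D2.
    rewrite (Rminus_0_r (Re (om s0))) in D1. rewrite (Rminus_0_r (Im (om s0))) in D2.
    apply small_range_W.
    - apply D1. repeat split; lra.
    - apply D2. repeat split; lra.
    - rewrite path_Im; [|lra]. apply Rmult_lt_0_compat; lra. }
  destruct Hs0 as [s0 [Hs0 [HI0 HD0]]].
  assert (HI : forall s, s0 <= s <= 1 -> 0 < Im (om s)).
  { intros s Hs. apply Rnot_le_lt. intros Hneg.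
    assert (Hex : exists s', s0 <= s' <= 1 /\ Im (om s') = 0).
    { destruct Hneg as [Hneg|Hneg]; [|now exists s].
      assert (s0 < s) by (destruct (proj1 Hs) as [K|K]; [exact K|subst; lra]).
      destruct (IVT_open (fun s => - Im (om s)) s0 s 0) as [s' [Hs' E]].
      - assumption.
      - intros u Hu. apply: continuous_opp. apply Hc. lra.
      - lra.
      - exists s'. split; [lra|]. lra. }
    destruct Hex as [s' [Hs' E]].
    pose proof (path_Im s' ltac:(lra)) as K. rewrite mulexp_Im_0 in K; [|exact E].
    change (0 = s' * Im z) in K. nra. }
  set (g := fun s => Im (om s) - atan (Re (om s) / Im (om s))).
  assert (Hg0 : forall s, s0 <= s <= 1 -> g s <> PI / 2).
  { intros s Hs E. pose proof (path_Im s ltac:(lra)) as K. pose proof (HI s Hs) as P.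
    unfold g in E. destruct (om s) as [x y]. unfold Re, Im in E, P; simpl in E, P.
    rewrite (mulexp_up x y P) E cos_PI2 in K. unfold Im at 1 in K; simpl in K. nra. }
  assert (Hg : g 1 < PI / 2).
  { apply Rnot_le_lt. intros [K|K]; [|apply (Hg0 1); lra].
    destruct (IVT_open g s0 1 (PI / 2)) as [s [Hs E]].
    - lra.
    - intros s Hs. destruct (Hc s ltac:(lra)) as [C1 C2].
      apply: continuous_minus; [exact C2|].
      apply (continuous_comp (fun s => Re (om s) / Im (om s)) atan).
      + apply: continuous_mult; [exact C1|].
        apply (continuous_comp (fun s => Im (om s)) Rinv); [exact C2|].
        apply continuous_Rinv. pose proof (HI s Hs). lra.
      + apply continuous_atan.
    - split; [|exact K]. unfold g. destruct (om s0) as [x y].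
      apply range_W_up in HD0; exact HI0 || exact HD0.
    - apply (Hg0 s); lra. }
  unfold g in Hg. pose proof (HI 1 ltac:(lra)) as P. destruct (om 1) as [x y].
  apply range_W_up; [exact P|exact Hg].
Qed.

(** If Im om > 0 while om exp om > 0, then the argument y + arg om is a positive multiple of
    2 pi, so that y > pi because arg om < pi.  A continuous path starting at 0 cannot jump over the
    ordinates in between. *)
Lemma path_Im_le_0 : Im z = 0 -> 0 < Re z -> Im (om 1) <= 0.
Proof.
  intros HI HR. apply Rnot_lt_le. intros Hpos. pose proof PI2_3_2.
  assert (Hbig : forall s, 0 < s <= 1 -> 0 < Im (om s) -> PI / 2 < Im (om s)).
  { intros s Hs P. apply Rnot_le_lt. intros L.
    pose proof (path_Im s ltac:(lra)) as K1. pose proof (path_Re s ltac:(lra)) as K2.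
    rewrite HI in K1. destruct (om s) as [x y]. change (Im (x, y)) with y in P, L.
    destruct (polar_up x y P) as [B [Cp _]].
    rewrite (mulexp_up x y P) in K1, K2. unfold Re at 1 in K2; unfold Im at 1 in K1.
    simpl in K1, K2. set (psi := atan (x / y)) in *.
    assert (Hm : 0 < exp x * (y / cos psi)).
    { apply Rmult_lt_0_compat; [apply exp_pos|apply Rdiv_lt_0_compat; lra]. }
    set (m := exp x * (y / cos psi)) in *.
    assert (0 < s * Re z) by (apply Rmult_lt_0_compat; lra).
    destruct (Rlt_le_dec (y - psi) (PI / 2)) as [C|C].
    - assert (0 < cos (y - psi)) by (apply cos_gt_0; lra). nra.
    - assert (0 < sin (y - psi)) by (apply sin_gt_0; lra). nra. }
  pose proof (Hbig 1 ltac:(lra) Hpos) as K.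
  (* 1 is an ordinate strictly between 0 and pi/2. *)
  destruct (IVT_open (fun s => Im (om s)) 0 1 1) as [s [Hs E]].
  - lra.
  - intros s Hs. apply (Hc s Hs).
  - rewrite H0. simpl. lra.
  - pose proof (Hbig s ltac:(lra) ltac:(lra)). lra.
Qed.

End Path.

(** The lower half plane is treated by conjugating the path; on the positive real axis the
    two cases together show that the path is real. *)
Lemma path_range_W (z : C) (om : R -> C) : ~ on_cut 0 z -> om 0 = 0%C ->
  (forall s, 0 <= s <= 1 -> ccontinuous om s) ->
  (forall s, 0 <= s <= 1 -> (om s * Cexp (om s))%C = (RtoC s * z)%C) ->
  range_W (om 1).
Proof.
  intros Hz H0 Hc He.
  set (om' := fun s => Cconj (om s)).
  assert (H0' : om' 0 = 0%C).
  { unfold om'. rewrite H0. apply C_ext; unfold Re, Im; simpl; ring. }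
  assert (Hc' : forall s, 0 <= s <= 1 -> ccontinuous om' s).
  { intros s Hs. destruct (Hc s Hs) as [C1 C2].
    split; [exact C1|exact (continuous_opp _ _ C2)]. }
  assert (He' : forall s, 0 <= s <= 1 -> (om' s * Cexp (om' s))%C = (RtoC s * Cconj z)%C).
  { intros s Hs. unfold om'. rewrite mulexp_conj (He s Hs).
    apply C_ext; unfold Re, Im; simpl; ring. }
  destruct (Rtotal_order (Im z) 0) as [H|[H|H]].
  - rewrite -(Cconj_conj (om 1)). apply range_W_conj.
    apply (path_range_W_up (Cconj z) om'); try assumption.
    destruct z; unfold Im in *; simpl in *; lra.
  - assert (HR : 0 < Re z).
    { apply Rnot_le_lt. intros K. apply Hz. now split. }
    pose proof (path_Im_le_0 z om H0 Hc He H HR) as L1.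
    pose proof (path_Im_le_0 (Cconj z) om' H0' Hc' He') as L2.
    assert (EI : Im (om 1) = 0).
    { assert (- Im (om 1) <= 0); [|lra]. apply L2; destruct z; unfold Re, Im in *; simpl in *; lra. }
    pose proof (He 1 ltac:(lra)) as E. rewrite mulexp_Im_0 in E; [|exact EI].
    assert (ER : Re (om 1) * exp (Re (om 1)) = Re z).
    { apply (f_equal Re) in E. destruct z; unfold Re in *; simpl in *. lra. }
    pose proof (exp_pos (Re (om 1))).
    split; rewrite EI; [pose proof PI2_3_2; lra|]. rewrite ycot_0. nra.
  - now apply (path_range_W_up z om).
Qed.

(** Translates between the metric of C as a normed field, used for complex derivatives,
    and the product topology of its coordinates. *)
Lemma holomorphic_continuous_line W z s :
  holomorphic_at W (RtoC s * z)%C -> ccontinuous (fun s => W (RtoC s * z)%C) s.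
Proof.
  intros H. apply ex_derive_continuous in H.
  assert (K : forall eps : posreal, exists d : posreal, forall u : R, Rabs (u - s) < d ->
     ball (W (RtoC s * z)%C) eps (W (RtoC u * z)%C)).
  { intros eps. destruct (H (fun y => ball (W (RtoC s * z)%C) eps y)) as [d Hd].
    - now exists eps.
    - assert (Hq : 0 < d / (Cmod z + 1)).
      { apply Rdiv_lt_0_compat; [apply cond_pos|]. pose proof (Cmod_ge_0 z). lra. }
      exists (mkposreal _ Hq). intros u Hu. apply Hd.
      change (Cmod (RtoC u * z - RtoC s * z)%C < d).
      replace (RtoC u * z - RtoC s * z)%C with (RtoC (u - s) * z)%C
        by (apply C_ext; unfold Re, Im; simpl; ring).
      rewrite Cmod_mult Cmod_R. change (Rabs (u - s) < d / (Cmod z + 1)) in Hu.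
      apply Rlt_div_r in Hu; [|pose proof (Cmod_ge_0 z); lra].
      pose proof (Rabs_pos (u - s)). nra. }
  split; intros P [eps HP]; destruct (K eps) as [d Hd]; exists d; intros u Hu;
  apply HP; apply (Hd u Hu).
Qed.

Lemma W_in_range_W W z : is_LambertW0 W -> ~ on_cut 0 z -> range_W (W z).
Proof.
  intros [Hhol [Heq H0]] Hz.
  assert (He1 : 0 < / exp 1) by (apply Rinv_0_lt_compat, exp_pos).
  assert (Hcut : forall s, 0 <= s <= 1 -> ~ on_cut (- / exp 1) (RtoC s * z)%C).
  { intros s Hs [K1 K2]. apply Hz.
    destruct z as [x y]. unfold Re, Im in *; simpl in *.
    assert (s <> 0) by (intros ->; lra).
    split; unfold Re, Im; simpl; nra. }
  replace z with (RtoC 1 * z)%C by ring.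
  apply (path_range_W z (fun s => W (RtoC s * z)%C)); try assumption.
  - replace (RtoC 0 * z)%C with (RtoC 0) by ring. exact H0.
  - intros s Hs. apply holomorphic_continuous_line. now apply Hhol, Hcut.
  - intros s Hs. now apply Heq, Hcut.
Qed.

(** * Numerical bounds for Re W(i) *)

(** The Taylor polynomials of exp (- x) at 0. *)
Fixpoint exp_neg_taylor (n : nat) (x : R) : R :=
  match n with
  | O => 1
  | S m => exp_neg_taylor m x + (- x) ^ n / INR (Factorial.fact n)
  end.

Lemma is_derive_exp_neg_taylor n x :
  is_derive (exp_neg_taylor (S n)) x (- exp_neg_taylor n x).
Proof.
  assert (Hm : forall k, is_derive (fun x => (- x) ^ S k / INR (Factorial.fact (S k))) x
     (- ((- x) ^ k / INR (Factorial.fact k)))).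
  { intros k. pose proof (INR_fact_neq_0 k). pose proof (INR_fact_neq_0 (S k)) as K.
    assert (HS : INR (S k) <> 0) by (apply not_0_INR; lia).
    evar_last.
    - apply: is_derive_scal_l. apply: is_derive_pow. apply: is_derive_opp. apply: is_derive_id.
    - rewrite fact_simpl mult_INR. unfold scal, opp, one; simpl pred.
      change (INR (S k) * - (1) * (- x) ^ k * / (INR (S k) * INR (Factorial.fact k)) =
        - ((- x) ^ k / INR (Factorial.fact k))).
      field. split; assumption. }
  induction n as [|n IH].
  - simpl. evar_last.
    + apply: is_derive_plus; [apply: is_derive_const|exact (Hm O)].
    + unfold plus, zero; simpl. field.
  - evar_last.
    + apply: is_derive_plus; [exact IH|exact (Hm (S n))].
    + unfold plus; simpl. ring.
Qed.

Lemma exp_neg_taylor_0 n : exp_neg_taylor n 0 = 1.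
Proof.
  induction n as [|n IH]; [reflexivity|].
  change (exp_neg_taylor n 0 + (- 0) ^ S n / INR (Factorial.fact (S n)) = 1).
  rewrite IH Ropp_0 pow_ne_zero; [|lia]. unfold Rdiv. ring.
Qed.

(** Integrating the inequality for n gives the one for n + 1 with the opposite sign. *)
Lemma exp_neg_taylor_bounds n x : 0 <= x ->
  0 <= (-1) ^ n * (exp_neg_taylor n x - exp (- x)).
Proof.
  revert x. induction n as [|n IH]; intros x Hx.
  - simpl. pose proof (exp_ineq1_le x). 
    assert (exp (- x) <= exp 0) by (destruct Hx as [Hx|<-]; [left; apply exp_increasing; lra|rewrite Ropp_0; lra]).
    rewrite exp_0 in H0. lra.
  - destruct Hx as [Hx|<-].
    2:{ rewrite exp_neg_taylor_0 Ropp_0 exp_0. right. ring. }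
    destruct (MVT_open (fun u => (-1) ^ S n * (exp_neg_taylor (S n) u - exp (- u)))
      (fun u => (-1) ^ n * (exp_neg_taylor n u - exp (- u))) 0 x) as [c [E Hc]]; [lra| |].
    + intros u _. evar_last.
      * apply: is_derive_scal. apply: is_derive_minus; [apply is_derive_exp_neg_taylor|].
        apply: is_derive_comp; [apply is_derive_exp|apply: is_derive_opp; apply: is_derive_id].
      * unfold minus, plus, opp, scal, one; simpl. unfold mult; simpl. ring.
    + rewrite exp_neg_taylor_0 Ropp_0 exp_0 in E.
      pose proof (IH c ltac:(lra)) as K.
      assert (0 <= (-1) ^ n * (exp_neg_taylor n c - exp (- c)) * (x - 0)) by (apply Rmult_le_pos; lra).
      lra.
Qed.

(** Obtained step by step with real arithmetic, since computing such factorials in unary is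
    out of reach. *)
Lemma fact_values :
  INR (Factorial.fact 2) = 2 /\ INR (Factorial.fact 3) = 6 /\ INR (Factorial.fact 4) = 24 /\
  INR (Factorial.fact 5) = 120 /\ INR (Factorial.fact 6) = 720 /\ INR (Factorial.fact 7) = 5040 /\
  INR (Factorial.fact 8) = 40320 /\ INR (Factorial.fact 9) = 362880 /\
  INR (Factorial.fact 10) = 3628800 /\ INR (Factorial.fact 11) = 39916800 /\
  INR (Factorial.fact 12) = 479001600 /\ INR (Factorial.fact 13) = 6227020800.
Proof.
  assert (Hs : forall k x, INR (Factorial.fact k) = x -> INR (Factorial.fact (S k)) = INR (S k) * x).
  { intros k x <-. rewrite fact_simpl mult_INR. reflexivity. }
  assert (H2 : INR (Factorial.fact 2) = 2) by (simpl; lra).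
  assert (H3 : INR (Factorial.fact 3) = 6) by (rewrite (Hs 2%nat _ H2); simpl; lra).
  assert (H4 : INR (Factorial.fact 4) = 24) by (rewrite (Hs 3%nat _ H3); simpl; lra).
  assert (H5 : INR (Factorial.fact 5) = 120) by (rewrite (Hs 4%nat _ H4); simpl; lra).
  assert (H6 : INR (Factorial.fact 6) = 720) by (rewrite (Hs 5%nat _ H5); simpl; lra).
  assert (H7 : INR (Factorial.fact 7) = 5040) by (rewrite (Hs 6%nat _ H6); simpl; lra).
  assert (H8 : INR (Factorial.fact 8) = 40320) by (rewrite (Hs 7%nat _ H7); simpl; lra).
  assert (H9 : INR (Factorial.fact 9) = 362880) by (rewrite (Hs 8%nat _ H8); simpl; lra).
  assert (H10 : INR (Factorial.fact 10) = 3628800) by (rewrite (Hs 9%nat _ H9); simpl; lra).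
  assert (H11 : INR (Factorial.fact 11) = 39916800) by (rewrite (Hs 10%nat _ H10); simpl; lra).
  assert (H12 : INR (Factorial.fact 12) = 479001600) by (rewrite (Hs 11%nat _ H11); simpl; lra).
  assert (H13 : INR (Factorial.fact 13) = 6227020800) by (rewrite (Hs 12%nat _ H12); simpl; lra).
  repeat split; assumption.
Qed.

Lemma cos_bounds_num y : 0 <= y <= 1 ->
  1 - y^2/2 + y^4/24 - y^6/720 + y^8/40320 - y^10/3628800 <= cos y <=
  1 - y^2/2 + y^4/24 - y^6/720 + y^8/40320 - y^10/3628800 + y^12/479001600.
Proof.
  intros Hy. pose proof PI2_3_2.
  destruct (cos_bound y 2) as [K1 K2]; [lra|lra|].
  destruct fact_values as (H2&H3&H4&H5&H6&H7&H8&H9&H10&H11&H12&H13).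
  assert (T : forall k m q, m = (2 * k)%nat -> INR (Factorial.fact m) = q ->
    cos_term y k = (-1) ^ k * (y ^ m / q)).
  { intros k m q -> <-. reflexivity. }
  change (2 * 2 + 1)%nat with 5%nat in K1. change (2 * (2 + 1))%nat with 6%nat in K2.
  unfold cos_approx, sum_f_R0 in K1, K2.
  rewrite (T 0%nat 0%nat 1 eq_refl eq_refl) (T 1%nat 2%nat _ eq_refl H2)
    (T 2%nat 4%nat _ eq_refl H4) (T 3%nat 6%nat _ eq_refl H6) (T 4%nat 8%nat _ eq_refl H8)
    (T 5%nat 10%nat _ eq_refl H10) in K1.
  rewrite (T 0%nat 0%nat 1 eq_refl eq_refl) (T 1%nat 2%nat _ eq_refl H2)
    (T 2%nat 4%nat _ eq_refl H4) (T 3%nat 6%nat _ eq_refl H6) (T 4%nat 8%nat _ eq_refl H8)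
    (T 5%nat 10%nat _ eq_refl H10) (T 6%nat 12%nat _ eq_refl H12) in K2.
  clear T H2 H3 H4 H5 H6 H7 H8 H9 H10 H11 H12 H13. split; lra.
Qed.

Lemma sin_bounds_num y : 0 <= y <= 1 ->
  y - y^3/6 + y^5/120 - y^7/5040 + y^9/362880 - y^11/39916800 <= sin y <=
  y - y^3/6 + y^5/120 - y^7/5040 + y^9/362880 - y^11/39916800 + y^13/6227020800.
Proof.
  intros Hy. pose proof PI2_3_2.
  destruct (sin_bound y 2) as [K1 K2]; [lra|lra|].
  destruct fact_values as (H2&H3&H4&H5&H6&H7&H8&H9&H10&H11&H12&H13).
  assert (T : forall k m q, m = (2 * k + 1)%nat -> INR (Factorial.fact m) = q ->
    sin_term y k = (-1) ^ k * (y ^ m / q)).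
  { intros k m q -> <-. reflexivity. }
  change (2 * 2 + 1)%nat with 5%nat in K1. change (2 * (2 + 1))%nat with 6%nat in K2.
  unfold sin_approx, sum_f_R0 in K1, K2.
  rewrite (T 0%nat 1%nat 1 eq_refl eq_refl) (T 1%nat 3%nat _ eq_refl H3)
    (T 2%nat 5%nat _ eq_refl H5) (T 3%nat 7%nat _ eq_refl H7) (T 4%nat 9%nat _ eq_refl H9)
    (T 5%nat 11%nat _ eq_refl H11) in K1.
  rewrite (T 0%nat 1%nat 1 eq_refl eq_refl) (T 1%nat 3%nat _ eq_refl H3)
    (T 2%nat 5%nat _ eq_refl H5) (T 3%nat 7%nat _ eq_refl H7) (T 4%nat 9%nat _ eq_refl H9)
    (T 5%nat 11%nat _ eq_refl H11) (T 6%nat 13%nat _ eq_refl H13) in K2.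
  clear T H2 H3 H4 H5 H6 H7 H8 H9 H10 H11 H12 H13. split; lra.
Qed.

Lemma exp_neg_bounds_num x : 0 <= x ->
  1 - x + x^2/2 - x^3/6 + x^4/24 - x^5/120 + x^6/720 - x^7/5040 + x^8/40320 - x^9/362880
  <= exp (- x) <=
  1 - x + x^2/2 - x^3/6 + x^4/24 - x^5/120 + x^6/720 - x^7/5040 + x^8/40320 - x^9/362880
   + x^10/3628800.
Proof.
  intros Hx.
  pose proof (exp_neg_taylor_bounds 9 x Hx) as K1. pose proof (exp_neg_taylor_bounds 10 x Hx) as K2.
  destruct fact_values as (H2&H3&H4&H5&H6&H7&H8&H9&H10&H11&H12&H13).
  assert (T : forall m q, INR (Factorial.fact (S m)) = q ->
    exp_neg_taylor (S m) x = exp_neg_taylor m x + (- x) ^ S m / q).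
  { intros m q <-. reflexivity. }
  rewrite (T 8%nat _ H9) (T 7%nat _ H8) (T 6%nat _ H7) (T 5%nat _ H6) (T 4%nat _ H5)
    (T 3%nat _ H4) (T 2%nat _ H3) (T 1%nat _ H2) (T 0%nat 1 eq_refl) in K1.
  rewrite (T 9%nat _ H10) (T 8%nat _ H9) (T 7%nat _ H8) (T 6%nat _ H7) (T 5%nat _ H6)
    (T 4%nat _ H5) (T 3%nat _ H4) (T 2%nat _ H3) (T 1%nat _ H2) (T 0%nat 1 eq_refl) in K2.
  change (exp_neg_taylor 0 x) with 1 in K1, K2.
  clear T H2 H3 H4 H5 H6 H7 H8 H9 H10 H11 H12 H13. split; lra.
Qed.

(** The argument of i is pi/2, so that psi = y, and the modulus of i is 1. *)
Lemma Ci_branch om : range_W om -> (om * Cexp om)%C = Ci ->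
  0 < Im om < PI / 2 /\ Re om = Im om * (sin (Im om) / cos (Im om)) /\
  logmod 0 (Im om) = 0.
Proof.
  destruct om as [x y]. intros HD E. change (Im (x, y)) with y. change (Re (x, y)) with x.
  assert (Hy : 0 < y).
  { destruct (Rtotal_order y 0) as [H|[H|H]]; [| |exact H]; exfalso.
    - pose proof (mulexp_Im_down (x, y) HD H) as K. rewrite E in K. simpl in K. lra.
    - rewrite (mulexp_Im_0 (x, y) H) in E. injection E. lra. }
  pose proof (proj1 (range_W_up x y Hy) HD) as HU.
  destruct (polar_up x y Hy) as [B [Cp X]].
  rewrite (mulexp_up x y Hy) in E. set (psi := atan (x / y)) in *.
  injection E as E1 E2.
  assert (Hm : 0 < exp x * (y / cos psi)).
  { apply Rmult_lt_0_compat; [apply exp_pos|apply Rdiv_lt_0_compat; lra]. }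
  set (m := exp x * (y / cos psi)) in *.
  assert (Es : sin (y - psi) = 0).
  { assert (K : m * sin (y - psi) = 0) by lra. apply Rmult_integral in K. destruct K; lra. }
  assert (Ey : y = psi).
  { pose proof PI2_3_2.
    destruct (Rtotal_order (y - psi) 0) as [K|[K|K]]; [|lra|].
    - pose proof (sin_gt_0 (psi - y) ltac:(lra) ltac:(lra)) as S.
      replace (psi - y) with (- (y - psi)) in S by ring. rewrite sin_neg in S. lra.
    - pose proof (sin_gt_0 (y - psi) ltac:(lra) ltac:(lra)). lra. }
  rewrite -Ey in X, Cp, B. split; [lra|]. split; [exact X|].
  unfold logmod. rewrite Rminus_0_r -X.
  assert (Em : m = 1).
  { replace (y - psi) with 0 in E2 by lra. rewrite cos_0 in E2. lra. }
  apply (f_equal ln) in Em. unfold m in Em. rewrite -Ey in Em.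
  rewrite ln_mult in Em; [|apply exp_pos|apply Rdiv_lt_0_compat; lra].
  rewrite ln_exp ln_div in Em; [|lra|lra]. rewrite ln_1 in Em. lra.
Qed.

Lemma logmod_sign y x : 0 < y < PI / 2 -> x = y * (sin y / cos y) ->
  (y / cos y < exp (- x) -> logmod 0 y < 0) /\ (exp (- x) < y / cos y -> 0 < logmod 0 y).
Proof.
  intros Hy Hx. assert (Hc : 0 < cos y) by (apply cos_gt_0; lra).
  unfold logmod. rewrite Rminus_0_r -Hx.
  assert (E : x + ln y - ln (cos y) = ln (y / cos y) - ln (exp (- x))).
  { rewrite ln_exp ln_div; lra. }
  rewrite E. assert (0 < y / cos y) by (apply Rdiv_lt_0_compat; lra).
  pose proof (exp_pos (- x)).
  split; intros K; apply ln_increasing in K; lra.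
Qed.

(** The two rational points are 8-digit approximations of Im W(i) from below and from above;
    y tan y is increasing. *)
Lemma Re_W_i_bounds om : range_W om -> (om * Cexp om)%C = Ci ->
  0.3746990 <= Re om < 0.3746991.
Proof.
  intros HD E. destruct (Ci_branch om HD E) as [Hy [Hx HL]].
  set (y := Im om) in *. set (x := Re om) in *. pose proof PI2_3_2.
  set (y1 := 0.57641272). set (y2 := 0.57641273).
  assert (Hc1 : 0.83842317896 <= cos y1 <= 0.83842317898).
  { pose proof (cos_bounds_num y1 ltac:(unfold y1; lra)). unfold y1 in *. lra. }
  assert (Hs1 : 0.545019791352 <= sin y1 <= 0.545019791353).
  { pose proof (sin_bounds_num y1 ltac:(unfold y1; lra)). unfold y1 in *. lra. }
  assert (Hc2 : 0.83842317351 <= cos y2 <= 0.83842317353).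
  { pose proof (cos_bounds_num y2 ltac:(unfold y2; lra)). unfold y2 in *. lra. }
  assert (Hs2 : 0.545019799736 <= sin y2 <= 0.545019799737).
  { pose proof (sin_bounds_num y2 ltac:(unfold y2; lra)). unfold y2 in *. lra. }
  set (x1 := y1 * (sin y1 / cos y1)). set (x2 := y2 * (sin y2 / cos y2)).
  assert (Hx1 : 0.374699016 <= x1 <= 0.374699017).
  { unfold x1. replace (y1 * (sin y1 / cos y1)) with (y1 * sin y1 / cos y1) by (field; lra).
    split; [apply (proj1 (Rle_div_r _ _ (cos y1) ltac:(lra)))|apply (proj2 (Rle_div_l _ _ (cos y1) ltac:(lra)))];
    unfold y1 in *; lra. }
  assert (Hx2 : 0.374699030 <= x2 <= 0.374699031).
  { unfold x2. replace (y2 * (sin y2 / cos y2)) with (y2 * sin y2 / cos y2) by (field; lra).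
    split; [apply (proj1 (Rle_div_r _ _ (cos y2) ltac:(lra)))|apply (proj2 (Rle_div_l _ _ (cos y2) ltac:(lra)))];
    unfold y2 in *; lra. }
  assert (L1 : logmod 0 y1 < 0).
  { apply (logmod_sign y1 x1); [unfold y1; lra|reflexivity|].
    apply Rle_lt_trans with 0.687496166.
    - apply (proj2 (Rle_div_l _ _ (cos y1) ltac:(lra))). unfold y1 in *. lra.
    - apply Rlt_le_trans with (exp (- (0.374699017))).
      + pose proof (exp_neg_bounds_num 0.374699017 ltac:(lra)). lra.
      + destruct (proj2 Hx1) as [K|K]; [left; apply exp_increasing; lra|rewrite K; lra]. }
  assert (L2 : 0 < logmod 0 y2).
  { apply (logmod_sign y2 x2); [unfold y2; lra|reflexivity|].
    apply Rle_lt_trans with (exp (- (0.374699030))).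
    - destruct (proj1 Hx2) as [K|K]; [left; apply exp_increasing; lra|rewrite -K; lra].
    - apply Rlt_le_trans with 0.687496170.
      + pose proof (exp_neg_bounds_num 0.374699030 ltac:(lra)). lra.
      + apply (proj1 (Rle_div_r _ _ (cos y2) ltac:(lra))). unfold y2 in *. lra. }
  assert (Hcos : forall u, 0 < u < PI / 2 -> 0 < cos (u - 0)).
  { intros u Hu. apply cos_gt_0; lra. }
  assert (B1 : y1 < y).
  { apply Rnot_le_lt. intros [K|K]; [|rewrite K in HL; lra].
    pose proof (logmod_incr 0 y y1 ltac:(lra) K). 
    assert (logmod 0 y < logmod 0 y1); [|lra]. apply H0.
    intros u Hu. apply Hcos. unfold y1 in *; lra. }
  assert (B2 : y < y2).
  { apply Rnot_le_lt. intros [K|K]; [|rewrite -K in HL; lra].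
    assert (logmod 0 y2 < logmod 0 y); [|lra].
    apply logmod_incr; [unfold y2; lra|exact K|].
    intros u Hu. apply Hcos. unfold y2 in *; lra. }
  assert (Htan : forall u v, 0 < u -> u < v -> v < PI / 2 ->
     u * (sin u / cos u) < v * (sin v / cos v)).
  { intros u v Hu Huv Hv. change (u * tan u < v * tan v).
    pose proof (tan_increasing u v ltac:(lra) Huv Hv). pose proof (tan_gt_0 u Hu ltac:(lra)). nra. }
  pose proof (Htan y1 y ltac:(unfold y1; lra) B1 ltac:(lra)) as T1. fold x1 in T1.
  pose proof (Htan y y2 ltac:(lra) B2 ltac:(unfold y2; lra)) as T2. fold x2 in T2.
  rewrite -Hx in T1, T2. lra.
Qed.

(** * The integral representation *)

Lemma is_RInt_integrand z : ~ on_cut 0 z ->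
  @is_RInt C_R_NormedModule (integrand z) 0 PI (CInt (ext_integrand z) 0 PI).
Proof.
  intros Hz. pose proof PI2_3_2.
  apply (is_RInt_ext (ext_integrand z)).
  - rewrite Rmin_left; [|lra]. rewrite Rmax_right; [|lra]. apply ext_integrand_in.
  - apply is_RInt_CInt; [lra|]. intros v Hv. now apply ccontinuous_ext_integrand.
Qed.

Lemma not_on_cut_Im a z : Im z <> 0 -> ~ on_cut a z.
Proof. intros H [K _]. contradiction. Qed.

(** (1 + i t) / (i - t) = - i, and the conjugate identity holds at - i. *)
Lemma integrand_Ci v : 0 < v < PI -> (integrand Ci v + integrand (- Ci)%C v)%C = 0%C.
Proof.
  intros Hv. pose proof (t_neg v Hv) as Ht. unfold integrand, K. fold (weight v).
  assert (Ht2 : 0 < 1 + t v ^ 2) by (pose proof (pow2_ge_0 (t v)); lra).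
  assert (Hn2 : RtoC (1 + t v ^ 2) <> 0%C) by (intros E; injection E as E; lra).
  assert (N1 : (Ci - RtoC (t v))%C <> 0%C) by (intros E; injection E; lra).
  assert (N2 : (- Ci - RtoC (t v))%C <> 0%C) by (intros E; injection E; lra).
  replace (1 + Ci * RtoC (t v))%C with (- Ci * (Ci - RtoC (t v)))%C
    by (apply C_ext; unfold Re, Im; simpl; ring).
  replace (1 + - Ci * RtoC (t v))%C with (Ci * (- Ci - RtoC (t v)))%C
    by (apply C_ext; unfold Re, Im; simpl; ring).
  field. repeat split; assumption.
Qed.

Lemma integral_Ci :
  (CInt (ext_integrand Ci) 0 PI + CInt (ext_integrand (- Ci)%C) 0 PI)%C = 0%C.
Proof.
  pose proof PI2_3_2.
  assert (H1 : ~ on_cut 0 Ci) by (apply not_on_cut_Im; simpl; lra).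
  assert (H2 : ~ on_cut 0 (- Ci)%C) by (apply not_on_cut_Im; simpl; lra).
  rewrite -CInt_plus; [|lra|intros; now apply ccontinuous_ext_integrand
    |intros; now apply ccontinuous_ext_integrand].
  rewrite (CInt_ext _ (fun _ => 0%C)); [|lra|].
  - rewrite CInt_const. ring.
  - intros v Hv. rewrite !ext_integrand_in; [|lra|lra]. now apply integrand_Ci.
Qed.

Theorem theorem7p2 (W : C -> C) (hW : is_LambertW0 W) :
  0.3746990 <= alpha0 W < 0.3746991 /\
  forall z : C, z <> RtoC 0 -> ~ on_cut 0 z ->
    @ex_RInt C_R_NormedModule (fun v : R => (K z v * RtoC (t v))%C) 0 PI /\
    W z = (RtoC (alpha0 W) +
           RtoC (/ PI) *
           @RInt C_R_CompleteNormedModule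
             (fun v : R => (K z v * RtoC (t v))%C) 0 PI)%C.
Proof.
  assert (Hi : ~ on_cut 0 Ci) by (apply not_on_cut_Im; simpl; lra).
  assert (Hi' : ~ on_cut 0 (- Ci)%C) by (apply not_on_cut_Im; simpl; lra).
  assert (He1 : 0 < / exp 1) by (apply Rinv_0_lt_compat, exp_pos).
  assert (HW : forall z, ~ on_cut 0 z -> (W z * Cexp (W z))%C = z).
  { intros z Hz. apply hW. intros [K1 K2]. apply Hz. split; [exact K1|lra]. }
  pose proof (W_in_range_W W) as HD.
  split; [apply Re_W_i_bounds; auto|].
  intros z _ Hz. pose proof (is_RInt_integrand z Hz) as HI.
  split; [eexists; exact HI|].
  rewrite (@is_RInt_unique C_R_CompleteNormedModule _ _ _ _ HI).
  set (I := CInt (ext_integrand z) 0 PI).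
  assert (Econj : W (- Ci)%C = Cconj (W Ci)).
  { apply mulexp_inj.
    - auto.
    - apply range_W_conj; auto.
    - rewrite HW; auto.
    - rewrite mulexp_conj !HW; auto. apply C_ext; unfold Re, Im; simpl; ring. }
  pose proof (integral_diff z (W z) Ci (W Ci) Hz (HD z hW Hz) (HW z Hz) Hi (HD _ hW Hi) (HW _ Hi)) as D1.
  pose proof (integral_diff z (W z) (- Ci)%C (W (- Ci)%C) Hz (HD z hW Hz) (HW z Hz) Hi'
    (HD _ hW Hi') (HW _ Hi')) as D2.
  pose proof integral_Ci as S. fold I in D1, D2. rewrite Econj in D2.
  assert (HPI : RtoC PI <> 0%C).
  { intros E. injection E as E. pose proof PI_RGT_0. lra. }
  assert (E2 : (W Ci + Cconj (W Ci))%C = (2 * RtoC (alpha0 W))%C).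
  { unfold alpha0. apply C_ext; unfold Re, Im; simpl; ring. }
  assert (E : (2 * I)%C = (RtoC PI * (2 * W z - 2 * RtoC (alpha0 W)))%C).
  { rewrite -E2.
    transitivity ((I - CInt (ext_integrand Ci) 0 PI) + (I - CInt (ext_integrand (- Ci)%C) 0 PI)
      + (CInt (ext_integrand Ci) 0 PI + CInt (ext_integrand (- Ci)%C) 0 PI))%C; [ring|].
    rewrite D1 D2 S. ring. }
  rewrite RtoC_inv; last (pose proof PI_RGT_0; lra).
  assert (EI : I = (RtoC PI * (W z - RtoC (alpha0 W)))%C).
  { transitivity (/ 2 * (2 * I))%C; [field|]. rewrite E. field. }
  rewrite EI. field. exact HPI.
Qed.
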